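(* Let $T$ be a pseudomonad on a $2$-category $\mathcal C$ and suppose that $\mathcal C$ admits colax bilimits of arrows. Then $T$ is lax-idempotent if and only if the forgetful $2$-functor $U^T \colon \mathrm{Ps}\text{-}T\text{-}\mathrm{Alg}_p \to \mathcal C$ is locally full and satisfies the colax bilimit property.
   Context: All $2$-categories are strict. $Ps(\mathcal A,\mathcal B)$ denotes the $2$-category of pseudofunctors, pseudonatural transformations and modifications. A pseudomonad on a $2$-category $\mathcal C$ consists of a pseudofunctor $T \colon \mathcal C \to \mathcal C$, pseudonatural transformations $\mu \colon T^2 \to T$ and $\eta \colon 1 \to T$, and invertible modifications $\alpha \colon \mu \circ T\mu \cong \mu \circ \mu_T$, $\lambda \colon \mu \circ \eta_T \cong 1_T$ and $\rho \colon 1_T \cong \mu \circ T\eta$ satisfying the usual coherence (higher associativity and unit) equations. It is lax-idempotent if the modification $\lambda \colon \mu\circ\eta_T \cong 1_T$ is the counit of an adjunction $\mu \dashv \eta_T$ in $Ps(\mathcal C,\mathcal C)$. $\mathrm{Ps}\text{-}T\text{-}\mathrm{Alg}_p$ denotes the $2$-category of pseudoalgebras for $T$, pseudomorphisms between them and algebra $2$-cells, and $U^T$ is its forgetful $2$-functor to $\mathcal C$. A pseudofunctor $U \colon \mathcal A \to \mathcal B$ is locally full if each functor $\mathcal A(A,B) \to \mathcal B(UA,UB)$ is full. Given a morphism $f \colon A \to B$ in a $2$-category $\mathcal C$, a colax bilimit of $f$ consists of an object $C$, $1$-cells $p \colon C \to A$ and $q \colon C \to B$, and a $2$-cell $\lambda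 \colon q \Rightarrow f \circ p$, such that for all $X \in \mathcal C$ the induced functor $\mathcal C(X,C) \to \mathcal C(X,B)/\mathcal C(X,f)$, $k \mapsto (qk, \lambda k \colon qk \to fpk, pk)$, to the comma category is an equivalence of categories. Here, for a functor $g \colon \mathcal X \to \mathcal Y$, the comma category $\mathcal Y/g$ has as objects triples $(y, \beta \colon y \to gx, x)$. $\mathcal C$ admits colax bilimits of arrows if every morphism of $\mathcal C$ has a colax bilimit. A pseudofunctor $U \colon \mathcal A \to \mathcal B$ satisfies the colax bilimit property if for all $A,B \in \mathcal A$ each morphism $f \colon UA \to UB$ in $\mathcal B$ has a colax bilimit of the form $(UC, Up, Uq, \lambda)$ with $C \in \mathcal A$, $p \colon C \to A$ and $q \colon C \to B$ morphisms of $\mathcal A$, and $\lambda \colon Uq \Rightarrow f \circ Up$ a $2$-cell of $\mathcal B$. *)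

(* Defs.v *)
From Stdlib Require Import ssreflect ssrfun.
From Stdlib Require Import FunctionalExtensionality ProofIrrelevance.
From Stdlib Require Import ClassicalEpsilon Eqdep.

Set Implicit Arguments.
Unset Strict Implicit.
Unset Printing Implicit Defensive.

(** * Strict 2-categories *)

(** Horizontal composition of 2-cells is given by the two whiskerings, subject to
    interchange; associativity and unitality of 1-cells are equalities. *)
Record TwoCatData := {
  ob :> Type;
  hom : ob -> ob -> Type;
  cell : forall A B, hom A B -> hom A B -> Type;
  id1 : forall A, hom A A;
  comp1 : forall A B C, hom B C -> hom A B -> hom A C;
  id2 : forall A B (f : hom A B), cell f f;
  vcomp : forall A B (f g h : hom A B), cell g h -> cell f g -> cell f h;
  lwhisk : forall A B C (g : hom B C) (f f' : hom A B),
    cell f f' -> cell (comp1 g f) (comp1 g f');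
  rwhisk : forall A B C (g g' : hom B C),
    cell g g' -> forall f : hom A B, cell (comp1 g f) (comp1 g' f) }.

Arguments hom {_} _ _.
Arguments cell {_ _ _} _ _.
Arguments id1 {_} _.
Arguments comp1 {_ _ _ _} _ _.
Arguments id2 {_ _ _} _.
Arguments vcomp {_ _ _ _ _ _} _ _.
Arguments lwhisk {_ _ _ _} _ {_ _} _.
Arguments rwhisk {_ _ _ _ _ _} _ _.

Declare Scope twocat_scope.
Delimit Scope twocat_scope with tc.
Open Scope twocat_scope.
Notation "g ∘ f" := (comp1 g f) (at level 40, left associativity) : twocat_scope.
Notation "β • α" := (vcomp β α) (at level 48, right associativity) : twocat_scope.
Notation "g ◁ α" := (lwhisk g α) (at level 45, no associativity) : twocat_scope.
Notation "α ▷ f" := (rwhisk α f) (at level 45, no associativity) : twocat_scope.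

(** The identity 2-cell between two equal 1-cells. *)
Definition eqc {C : TwoCatData} {A B : C} {f g : hom A B} (e : f = g) : cell f g :=
  match e in _ = g return cell f g with eq_refl => id2 f end.

Record TwoCat := {
  tcdata :> TwoCatData;
  vcompA : forall (A B : tcdata) (f g h k : hom A B)
      (c : cell h k) (b : cell g h) (a : cell f g), c • (b • a) = (c • b) • a;
  vcomp1c : forall (A B : tcdata) (f g : hom A B) (a : cell f g), id2 g • a = a;
  vcompc1 : forall (A B : tcdata) (f g : hom A B) (a : cell f g), a • id2 f = a;
  lwhisk_id : forall (A B C : tcdata) (g : hom B C) (f : hom A B),
      g ◁ id2 f = id2 (g ∘ f);
  lwhisk_vcomp : forall (A B C : tcdata) (g : hom B C) (f f' f'' : hom A B)
      (b : cell f' f'') (a : cell f f'), g ◁ (b • a) = (g ◁ b) • (g ◁ a);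
  rwhisk_id : forall (A B C : tcdata) (g : hom B C) (f : hom A B),
      id2 g ▷ f = id2 (g ∘ f);
  rwhisk_vcomp : forall (A B C : tcdata) (f : hom A B) (g g' g'' : hom B C)
      (b : cell g' g'') (a : cell g g'), (b • a) ▷ f = (b ▷ f) • (a ▷ f);
  interchange : forall (A B C : tcdata) (g g' : hom B C) (f f' : hom A B)
      (b : cell g g') (a : cell f f'), (b ▷ f') • (g ◁ a) = (g' ◁ a) • (b ▷ f);
  comp1A : forall (A B C D : tcdata) (h : hom C D) (g : hom B C) (f : hom A B),
      h ∘ (g ∘ f) = (h ∘ g) ∘ f;
  comp11f : forall (A B : tcdata) (f : hom A B), id1 B ∘ f = f;
  comp1f1 : forall (A B : tcdata) (f : hom A B), f ∘ id1 A = f;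
  lwhisk_comp : forall (A B C D : tcdata) (h : hom C D) (g : hom B C)
      (f f' : hom A B) (a : cell f f'),
      eqc (comp1A h g f') • (h ◁ (g ◁ a)) = ((h ∘ g) ◁ a) • eqc (comp1A h g f);
  lrwhisk_comp : forall (A B C D : tcdata) (h : hom C D) (g g' : hom B C)
      (a : cell g g') (f : hom A B),
      eqc (comp1A h g' f) • (h ◁ (a ▷ f)) = ((h ◁ a) ▷ f) • eqc (comp1A h g f);
  rwhisk_comp : forall (A B C D : tcdata) (h h' : hom C D) (a : cell h h')
      (g : hom B C) (f : hom A B),
      eqc (comp1A h' g f) • (a ▷ (g ∘ f)) = ((a ▷ g) ▷ f) • eqc (comp1A h g f);
  lwhisk_1 : forall (A B : tcdata) (f f' : hom A B) (a : cell f f'),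
      eqc (comp11f f') • (id1 B ◁ a) = a • eqc (comp11f f);
  rwhisk_1 : forall (A B : tcdata) (f f' : hom A B) (a : cell f f'),
      eqc (comp1f1 f') • (a ▷ id1 A) = a • eqc (comp1f1 f) }.

Ltac strict1 :=
  first [ reflexivity
        | cbn; repeat first [rewrite comp1A | rewrite comp11f | rewrite comp1f1];
          reflexivity ].

(** [idc] stands for the identity 2-cell between two 1-cells which are equal by
    strict associativity and unitality; its ends are read off from the context. *)
Class StrictEq {C : TwoCat} {A B : C} (f g : hom A B) := strict_eq : f = g.
#[global] Hint Mode StrictEq + + + + + : typeclass_instances.
#[global] Hint Extern 0 (StrictEq _ _) => (unfold StrictEq; strict1) : typeclass_instances.
Notation idc := (eqc strict_eq).

Record iso2 {C : TwoCat} {A B : C} (f g : hom A B) := Iso2 {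
  fwd :> cell f g;
  bwd : cell g f;
  fwd_bwd : fwd • bwd = id2 g;
  bwd_fwd : bwd • fwd = id2 f }.
Arguments bwd {_ _ _ _ _} _.

(** * Reasoning up to strictness

    A 2-cell packed with its ends, under a composition which is [None] when the
    ends do not match; identities between equal 1-cells become invisible. *)

Section Packed.
Context {C : TwoCat}.

Definition pcell (A B : C) := option {f : hom A B & {g : hom A B & cell f g}}.

Definition pk {A B : C} {f g : hom A B} (a : cell f g) : pcell A B :=
  Some (existT _ f (existT _ g a)).

Definition pc {A B : C} (y x : pcell A B) : pcell A B :=
  match y, x with
  | Some (existT _ g' (existT _ h b)), Some (existT _ f (existT _ g a)) =>
      match excluded_middle_informative (g = g') with
      | left e => pk (b • eqc e • a)
      | right _ => None
      end
  | _, _ => None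
  end.

Definition pl {A B D : C} (g : hom B D) (x : pcell A B) : pcell A D :=
  match x with
  | Some (existT _ _ (existT _ _ a)) => pk (g ◁ a)
  | None => None
  end.

Definition pr {A B D : C} (x : pcell B D) (f : hom A B) : pcell A D :=
  match x with
  | Some (existT _ _ (existT _ _ a)) => pk (a ▷ f)
  | None => None
  end.

Lemma pk_inj (A B : C) (f g : hom A B) (a b : cell f g) : pk a = pk b -> a = b.
Proof.
case=> H; have H1 := inj_pair2 _ _ _ _ _ H; exact: inj_pair2 _ _ _ _ _ H1.
Qed.

Lemma eqc_irr (A B : C) (f g : hom A B) (e e' : f = g) :
  eqc e = eqc e' :> cell f g.
Proof. by rewrite (proof_irrelevance _ e e'). Qed.

Lemma eqc_id (A B : C) (f : hom A B) (e : f = f) : eqc e = id2 f.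
Proof. by rewrite (eqc_irr e eq_refl). Qed.

Lemma pk_eqcl (A B : C) (f g h : hom A B) (e : g = h) (a : cell f g) :
  pk (eqc e • a) = pk a.
Proof. by case: h / e; rewrite /= vcomp1c. Qed.

Lemma pk_eqcr (A B : C) (f g h : hom A B) (e : h = f) (a : cell f g) :
  pk (a • eqc e) = pk a.
Proof. by move: a; case: f / e => a; rewrite /= vcompc1. Qed.

Lemma pk_vcomp (A B : C) (f g h : hom A B) (b : cell g h) (a : cell f g) :
  pk (b • a) = pc (pk b) (pk a).
Proof.
rewrite /pc /=; case: excluded_middle_informative => // e.
by rewrite eqc_id vcomp1c.
Qed.

Lemma pk_vcomp_eqc (A B : C) (f g g' h : hom A B) (b : cell g' h) (e : g = g')
  (a : cell f g) : pk (b • eqc e • a) = pc (pk b) (pk a).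
Proof. by rewrite pk_vcomp pk_eqcl. Qed.

Lemma pk_lwhisk (A B D : C) (g : hom B D) (f f' : hom A B) (a : cell f f') :
  pk (g ◁ a) = pl g (pk a).
Proof. by []. Qed.

Lemma pk_rwhisk (A B D : C) (g g' : hom B D) (a : cell g g') (f : hom A B) :
  pk (a ▷ f) = pr (pk a) f.
Proof. by []. Qed.

Lemma pk_eqc (A B : C) (f g : hom A B) (e : f = g) : pk (eqc e) = pk (id2 f).
Proof. by case: g / e. Qed.

Lemma pcA (A B : C) (z y x : pcell A B) : pc z (pc y x) = pc (pc z y) x.
Proof.
case: z => [[h1 [k c]]|]; case: y => [[g1 [h b]]|]; case: x => [[f [g a]]|] //=.
- case: (excluded_middle_informative (g = g1)) => [e1|n1] /=.
  + case: (excluded_middle_informative (h = h1)) => [e2|n2] //=.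
    case: (excluded_middle_informative (g = g1)) => [e3|n3] //=.
    by rewrite !vcompA (eqc_irr e1 e3).
  + case: (excluded_middle_informative (h = h1)) => [e2|n2] //=.
    by case: (excluded_middle_informative (g = g1)).
- by case: (excluded_middle_informative (h = h1)).
Qed.

Lemma pl_pl (A B D E : C) (h : hom D E) (g : hom B D) (x : pcell A B) :
  pl h (pl g x) = pl (h ∘ g) x.
Proof.
case: x => [[f [f' a]]|] //=.
by rewrite -(pk_eqcl (comp1A h g f')) lwhisk_comp pk_eqcr.
Qed.

Lemma pr_pl (A B D E : C) (h : hom D E) (x : pcell B D) (f : hom A B) :
  pr (pl h x) f = pl h (pr x f).
Proof.
case: x => [[g [g' a]]|] //=.
by rewrite -(pk_eqcl (comp1A h g' f)) lrwhisk_comp pk_eqcr.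
Qed.

Lemma pr_pr (A B D E : C) (x : pcell D E) (g : hom B D) (f : hom A B) :
  pr (pr x g) f = pr x (g ∘ f).
Proof.
case: x => [[h [h' a]]|] //=.
by rewrite -[RHS](pk_eqcl (comp1A h' g f)) rwhisk_comp pk_eqcr.
Qed.

Lemma pl_1 (A B : C) (x : pcell A B) : pl (id1 B) x = x.
Proof.
case: x => [[f [f' a]]|] //=.
by rewrite -(pk_eqcl (comp11f f')) lwhisk_1 pk_eqcr.
Qed.

Lemma pr_1 (A B : C) (x : pcell A B) : pr x (id1 A) = x.
Proof.
case: x => [[f [f' a]]|] //=.
by rewrite -(pk_eqcl (comp1f1 f')) rwhisk_1 pk_eqcr.
Qed.

Lemma lwhisk_eqc (A B D : C) (g : hom B D) (f f' : hom A B) (e : f = f') :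
  g ◁ eqc e = eqc (f_equal (comp1 g) e).
Proof. by case: f' / e; rewrite /= lwhisk_id. Qed.

Lemma rwhisk_eqc (A B D : C) (g g' : hom B D) (e : g = g') (f : hom A B) :
  eqc e ▷ f = eqc (f_equal (fun g => g ∘ f) e).
Proof. by case: g' / e; rewrite /= rwhisk_id. Qed.

Lemma eqc_vcomp (A B : C) (f g h : hom A B) (e : f = g) (e' : g = h) :
  eqc e' • eqc e = eqc (eq_trans e e').
Proof. by case: h / e'; rewrite /= vcomp1c. Qed.

Lemma pc_id (A B : C) (f : hom A B) (g h : hom A B) (a : cell g h) :
  h = f -> pc (pk (id2 f)) (pk a) = pk a.
Proof. by move=> e; case: f / e; rewrite -pk_vcomp vcomp1c. Qed.

Lemma pcl_id (A B : C) (f : hom A B) (g h : hom A B) (a : cell g h) :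
  g = f -> pc (pk a) (pk (id2 f)) = pk a.
Proof. by move=> e; case: f / e; rewrite -pk_vcomp vcompc1. Qed.

Lemma iso2_ext (A B : C) (f g : hom A B) (i j : iso2 f g) :
  fwd i = fwd j -> i = j.
Proof.
case: i => a b ab ba; case: j => a' b' ab' ba' /= E; case: a' / E ab' ba' => ab' ba'.
have E : b = b' by rewrite -(vcompc1 b) -ab' vcompA ba vcomp1c.
by case: b' / E ab' ba' => ab' ba'; f_equal; apply: proof_irrelevance.
Qed.

End Packed.

(** * Pseudofunctors *)

Record Pseudofunctor (A B : TwoCat) := {
  pf0 :> A -> B;
  pf1 : forall x y : A, hom x y -> hom (pf0 x) (pf0 y);
  pf2 : forall (x y : A) (f g : hom x y), cell f g -> cell (pf1 f) (pf1 g);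
  pfC : forall (x y z : A) (g : hom y z) (f : hom x y),
      iso2 (pf1 g ∘ pf1 f) (pf1 (g ∘ f));
  pfU : forall x : A, iso2 (id1 (pf0 x)) (pf1 (id1 x));
  pf2_id : forall (x y : A) (f : hom x y), pf2 (id2 f) = id2 (pf1 f);
  pf2_vcomp : forall (x y : A) (f g h : hom x y) (b : cell g h) (a : cell f g),
      pf2 (b • a) = pf2 b • pf2 a;
  pfC_lwhisk : forall (x y z : A) (g : hom y z) (f f' : hom x y) (a : cell f f'),
      pfC g f' • (pf1 g ◁ pf2 a) = pf2 (g ◁ a) • pfC g f;
  pfC_rwhisk : forall (x y z : A) (g g' : hom y z) (b : cell g g') (f : hom x y),
      pfC g' f • (pf2 b ▷ pf1 f) = pf2 (b ▷ f) • pfC g f;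
  pfC_assoc : forall (w x y z : A) (h : hom y z) (g : hom x y) (f : hom w x),
      pf2 (eqc (comp1A h g f)) • pfC h (g ∘ f) • (pf1 h ◁ pfC g f)
      = pfC (h ∘ g) f • (pfC h g ▷ pf1 f) • idc;
  pfC_unitl : forall (x y : A) (f : hom x y),
      pf2 (eqc (comp11f f)) • pfC (id1 y) f • (pfU y ▷ pf1 f) = idc;
  pfC_unitr : forall (x y : A) (f : hom x y),
      pf2 (eqc (comp1f1 f)) • pfC f (id1 x) • (pf1 f ◁ pfU x) = idc }.

Arguments pf1 {A B} _ {x y} _.
Arguments pf2 {A B} _ {x y f g} _.
Arguments pfC {A B} _ {x y z} _ _.
Arguments pfU {A B} _ _.

Section Pseudofunctors.
Context {A B : TwoCat}.

Lemma pf2_eqc (F : Pseudofunctor A B) (x y : A) (f g : hom x y) (e : f = g) :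
  pf2 F (eqc e) = eqc (f_equal (pf1 F) e).
Proof. by case: g / e; rewrite /= pf2_id. Qed.

End Pseudofunctors.

Ltac pnorm :=
  repeat first
    [ rewrite pl_pl | rewrite pr_pl | rewrite pr_pr | rewrite pl_1 | rewrite pr_1
    | rewrite -pcA | rewrite comp1A | rewrite comp11f | rewrite comp1f1 ].

Section Normalization.
Context {C : TwoCat}.

Definition inv2 {A B : C} {f g : hom A B} (a : cell f g) : Prop := exists e, a = eqc e.
Definition wk {A' A B B' : C} (h : hom B B') (f : hom A' A) {g g' : hom A B}
  (a : cell g g') : pcell A' B' := pl h (pr (pk a) f).

Lemma inv2_eqc (A B : C) (f g : hom A B) (e : f = g) : inv2 (eqc e).
Proof. by exists e. Qed.
Lemma inv2_id (A B : C) (f : hom A B) : inv2 (id2 f).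
Proof. by exists eq_refl. Qed.
Lemma inv2_vcomp (A B : C) (f g h : hom A B) (b : cell g h) (a : cell f g) :
  inv2 b -> inv2 a -> inv2 (b • a).
Proof. by case=> e ->; case=> e' ->; rewrite eqc_vcomp; exact: inv2_eqc. Qed.
Lemma inv2_lwhisk (A B D : C) (g : hom B D) (f f' : hom A B) (a : cell f f') :
  inv2 a -> inv2 (g ◁ a).
Proof. by case=> e ->; rewrite lwhisk_eqc; exact: inv2_eqc. Qed.
Lemma inv2_rwhisk (A B D : C) (g g' : hom B D) (a : cell g g') (f : hom A B) :
  inv2 a -> inv2 (a ▷ f).
Proof. by case=> e ->; rewrite rwhisk_eqc; exact: inv2_eqc. Qed.

Context {A' A B B' : C} {h : hom B B'} {f : hom A' A}.

Lemma wk_start (g g' : hom A B) (a : cell g g') R :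
  wk (id1 B) (id1 A) a = R -> pk a = R.
Proof. by rewrite /wk pl_1 pr_1. Qed.
Lemma wk_vcompE (g g' g'' : hom A B) (b : cell g' g'') (a : cell g g') :
  wk h f (b • a) = pc (wk h f b) (wk h f a).
Proof.
rewrite /wk -(pk_rwhisk (b • a)) -(pk_rwhisk a) -(pk_rwhisk b) -!pk_lwhisk -pk_vcomp.
by rewrite rwhisk_vcomp lwhisk_vcomp.
Qed.
Lemma wk0_vcomp (g g' g'' : hom A B) (b : cell g' g'') (a : cell g g') X R :
  wk h f a = X -> pc (wk h f b) X = R -> wk h f (b • a) = R.
Proof. by rewrite wk_vcompE => -> ->. Qed.
Lemma wk1_vcomp (g g' g'' : hom A B) (b : cell g' g'') (a : cell g g')
  X Y R :
  pc (wk h f a) X = Y -> pc (wk h f b) Y = R -> pc (wk h f (b • a)) X = R.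
Proof. by rewrite wk_vcompE -pcA => -> ->. Qed.
Lemma wk_invl (g g' g'' : hom A B) (b : cell g' g'') (a : cell g g') :
  inv2 b -> wk h f (b • a) = wk h f a.
Proof. by case=> e ->; rewrite /wk pk_eqcl. Qed.
Lemma wk_invr (g g' g'' : hom A B) (b : cell g' g'') (a : cell g g') :
  inv2 a -> wk h f (b • a) = wk h f b.
Proof. by case=> e ->; rewrite /wk pk_eqcr. Qed.
Lemma wk_inv (g g' : hom A B) (a : cell g g') :
  inv2 a -> wk h f a = pk (id2 (h ∘ (g ∘ f))).
Proof. by case=> e ->; rewrite /wk pk_eqc /= rwhisk_id lwhisk_id. Qed.
Lemma wk_lwhisk (D : C) (k : hom D B) (g g' : hom A D) (a : cell g g') :
  wk h f (k ◁ a) = wk (h ∘ k) f a.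
Proof. by rewrite /wk pk_lwhisk pr_pl pl_pl. Qed.
Lemma wk_rwhisk (D : C) (k : hom A D) (g g' : hom D B) (a : cell g g') :
  wk h f (a ▷ k) = wk h (k ∘ f) a.
Proof. by rewrite /wk pk_rwhisk pr_pr. Qed.

Lemma wk_lr (g g' : hom A B) (a : cell g g') h' f' x :
  h = h' -> f = f' -> pk a = x -> wk h f a = pl h' (pr x f').
Proof. by move=> -> -> <-. Qed.
Lemma wk_1r (g g' : hom A B) (a : cell g g') (k : hom B B) f' x :
  k = id1 B -> f = f' -> pk a = x -> wk k f a = pr x f'.
Proof. by move=> -> -> <-; rewrite /wk pl_1. Qed.
Lemma wk_l1 (g g' : hom A B) (a : cell g g') h' (k : hom A A) x :
  h = h' -> k = id1 A -> pk a = x -> wk h k a = pl h' x.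
Proof. by move=> -> -> <-; rewrite /wk pr_1. Qed.
Lemma wk_11 (g g' : hom A B) (a : cell g g') (k : hom B B) (k' : hom A A) x :
  k = id1 B -> k' = id1 A -> pk a = x -> wk k k' a = x.
Proof. by move=> -> -> <-; rewrite /wk pr_1 pl_1. Qed.
End Normalization.

Lemma inv2_pf2 (A B : TwoCat) (F : Pseudofunctor A B) (x y : A) (f g : hom x y)
  (a : cell f g) : inv2 a -> inv2 (pf2 F a).
Proof. by case=> e ->; rewrite pf2_eqc; exact: inv2_eqc. Qed.

Ltac is_inv t :=
  lazymatch t with
  | eqc _ => idtac
  | id2 _ => idtac
  | vcomp ?b ?a => is_inv b; is_inv a
  | lwhisk _ ?a => is_inv a
  | rwhisk ?a _ => is_inv a
  | pf2 _ ?a => is_inv a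
  end.
Ltac solve_inv := repeat first [apply inv2_eqc | apply inv2_id | apply inv2_vcomp
  | apply inv2_lwhisk | apply inv2_rwhisk | apply inv2_pf2].
Ltac norm1 := repeat first [rewrite comp1A | rewrite comp11f | rewrite comp1f1];
  reflexivity.

Ltac simp1 h :=
  lazymatch h with
  | comp1 (id1 _) ?k => simp1 k
  | comp1 ?k (id1 _) => simp1 k
  | comp1 ?h' ?k => let a := simp1 h' in let b := simp1 k in
      lazymatch a with
      | id1 _ => b
      | _ => lazymatch b with id1 _ => a | _ => h end
      end
  | _ => h
  end.
Ltac wk_base h f :=
  let h' := simp1 h in let f' := simp1 f in
  lazymatch h' with
  | id1 _ => lazymatch f' with
     | id1 _ => eapply wk_11; norm1
     | _ => eapply wk_1r; norm1
     end
  | _ => lazymatch f' with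
     | id1 _ => eapply wk_l1; norm1
     | _ => eapply wk_lr; norm1
     end
  end.
Ltac wk_norm :=
  lazymatch goal with
  | |- wk ?h ?f ?t = _ =>
    tryif is_inv t then (apply wk_inv; solve_inv) else
    lazymatch t with
    | vcomp ?b ?a =>
        tryif is_inv b then (etransitivity; [apply wk_invl; solve_inv | wk_norm]) else
        tryif is_inv a then (etransitivity; [apply wk_invr; solve_inv | wk_norm]) else
        (eapply wk0_vcomp; [wk_norm | wk_norm])
    | lwhisk _ _ => etransitivity; [apply wk_lwhisk | wk_norm]
    | rwhisk _ _ => etransitivity; [apply wk_rwhisk | wk_norm]
    | pf2 ?F (vcomp _ _) => rewrite pf2_vcomp; wk_norm
    | _ => wk_base h f
    end
  | |- pc (wk ?h ?f ?t) ?X = _ =>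
    lazymatch t with
    | vcomp ?b ?a =>
        tryif is_inv b then
          (etransitivity; [apply (f_equal (fun z => pc z X)); apply wk_invl; solve_inv
                          | cbv beta; wk_norm]) else
        tryif is_inv a then
          (etransitivity; [apply (f_equal (fun z => pc z X)); apply wk_invr; solve_inv
                          | cbv beta; wk_norm]) else
        (eapply wk1_vcomp; [wk_norm | wk_norm])
    | lwhisk _ _ => etransitivity;
        [apply (f_equal (fun z => pc z X)); apply wk_lwhisk | cbv beta; wk_norm]
    | rwhisk _ _ => etransitivity;
        [apply (f_equal (fun z => pc z X)); apply wk_rwhisk | cbv beta; wk_norm]
    | pf2 ?F (vcomp _ _) => rewrite pf2_vcomp; wk_norm
    | _ => apply (f_equal (fun z => pc z X)); wk_base h f
    end
  end.

Ltac pack :=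
  cbn;
  lazymatch goal with
  | |- pk _ = pk _ =>
    etransitivity; [apply wk_start; wk_norm |];
    symmetry; etransitivity; [apply wk_start; wk_norm |]; symmetry
  end.
Ltac topack H :=
  cbn in H;
  lazymatch type of H with
  | ?a = ?b =>
    let L := fresh "L" in let R := fresh "R" in
    eassert (L : pk a = _) by (apply wk_start; wk_norm);
    eassert (R : pk b = _) by (apply wk_start; wk_norm);
    apply (f_equal pk) in H;
    apply (eq_trans (esym L)) in H; apply (fun H => eq_trans H R) in H; clear L R
  end.

Lemma tail2 (C : TwoCat) (A B : C) (a b r : pcell A B) : pc a b = r ->
  forall X, pc a (pc b X) = pc r X.
Proof. by move=> <- X; rewrite pcA. Qed.
Lemma tail3 (C : TwoCat) (A B : C) (a b c r : pcell A B) : pc a (pc b c) = r ->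
  forall X, pc a (pc b (pc c X)) = pc r X.
Proof. by move=> <- X; rewrite !pcA. Qed.

Definition Tgt {C : TwoCat} {A B : C} (x : pcell A B) (f : hom A B) : Prop :=
  match x with Some (existT _ _ (existT _ g _)) => g = f | None => True end.
Definition Src {C : TwoCat} {A B : C} (x : pcell A B) (f : hom A B) : Prop :=
  match x with Some (existT _ g _) => g = f | None => True end.

Lemma Tgt_pc (C : TwoCat) (A B : C) (y x : pcell A B) f : Tgt y f -> Tgt (pc y x) f.
Proof.
case: y => [[g [h b]]|] //=; case: x => [[g' [h' a]]|] //=.
by case: excluded_middle_informative.
Qed.
Lemma Src_pc (C : TwoCat) (A B : C) (y x : pcell A B) f : Src x f -> Src (pc y x) f.
Proof.
case: y => [[g [h b]]|] //=; case: x => [[g' [h' a]]|] //=.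
by case: excluded_middle_informative.
Qed.
Lemma pc_eqcl (C : TwoCat) (A B : C) (f g : hom A B) (e : f = g) x :
  Tgt x f -> pc (pk (eqc e)) x = x.
Proof.
case: g / e; case: x => [[h [h' a]]|] //= e.
by apply: pc_id.
Qed.
Lemma pc_eqcr (C : TwoCat) (A B : C) (f g : hom A B) (e : f = g) x :
  Src x g -> pc x (pk (eqc e)) = x.
Proof.
case: g / e; case: x => [[h [h' a]]|] //= e.
by apply: pcl_id.
Qed.
Lemma pc_idl (C : TwoCat) (A B : C) (f : hom A B) x : Tgt x f -> pc (pk (id2 f)) x = x.
Proof. exact: (@pc_eqcl _ _ _ f f eq_refl). Qed.
Lemma pc_idr (C : TwoCat) (A B : C) (f : hom A B) x : Src x f -> pc x (pk (id2 f)) = x.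
Proof. exact: (@pc_eqcr _ _ _ f f eq_refl). Qed.
Lemma pk_id_eq (C : TwoCat) (A B : C) (f f' : hom A B) :
  f = f' -> pk (id2 f) = pk (id2 f').
Proof. by move=> E; case: f' / E. Qed.

Ltac strict := solve [repeat first [apply Tgt_pc | apply Src_pc]; cbn; strict1].
Ltac noeqc := repeat first [rewrite pc_eqcl; [strict|] | rewrite pc_eqcr; [strict|]
  | rewrite pc_idl; [strict|] | rewrite pc_idr; [strict|] ];
  rewrite ?pk_eqc; try solve [reflexivity | apply: pk_id_eq; strict1].
Ltac prw H := first [rewrite (tail3 H) | rewrite (tail2 H) | rewrite H]; rewrite -?pcA.

Ltac isotriv := cbn; rewrite ?lwhisk_id ?rwhisk_id ?vcomp1c ?vcompc1; solve [reflexivity | apply eqc_irr].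

#[local] Obligation Tactic := intros; cbn.

Program Definition pf_id (A : TwoCat) : Pseudofunctor A A :=
  {| pf0 := fun x => x; pf1 := fun x y f => f; pf2 := fun x y f g a => a;
     pfC := fun x y z g f => @Iso2 _ _ _ (g ∘ f) (g ∘ f) (id2 _) (id2 _) _ _;
     pfU := fun x => @Iso2 _ _ _ (id1 x) (id1 x) (id2 _) (id2 _) _ _ |}.
Solve All Obligations with intros; isotriv.

Program Definition pf_comp (A B C : TwoCat) (G : Pseudofunctor B C)
  (F : Pseudofunctor A B) : Pseudofunctor A C :=
  {| pf0 := fun x => G (F x);
     pf1 := fun x y f => pf1 G (pf1 F f);
     pf2 := fun x y f g a => pf2 G (pf2 F a);
     pfC := fun x y z g f => @Iso2 _ _ _ (pf1 G (pf1 F g) ∘ pf1 G (pf1 F f)) _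
       (pf2 G (pfC F g f) • pfC G (pf1 F g) (pf1 F f))
       (bwd (pfC G (pf1 F g) (pf1 F f)) • pf2 G (bwd (pfC F g f))) _ _;
     pfU := fun x => @Iso2 _ _ _ (id1 (G (F x))) _
       (pf2 G (pfU F x) • pfU G (F x))
       (bwd (pfU G (F x)) • pf2 G (bwd (pfU F x))) _ _ |}.
Next Obligation.
by rewrite -vcompA (vcompA (pfC G _ _)) fwd_bwd vcomp1c -pf2_vcomp fwd_bwd pf2_id.
Qed.
Next Obligation.
by rewrite -vcompA (vcompA (pf2 G _)) -pf2_vcomp bwd_fwd pf2_id vcomp1c bwd_fwd.
Qed.
Next Obligation.
by rewrite -vcompA (vcompA (pfU G _)) fwd_bwd vcomp1c -pf2_vcomp fwd_bwd pf2_id.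
Qed.
Next Obligation.
by rewrite -vcompA (vcompA (pf2 G _)) -pf2_vcomp bwd_fwd pf2_id vcomp1c bwd_fwd.
Qed.
Next Obligation. by rewrite !pf2_id. Qed.
Next Obligation. by rewrite !pf2_vcomp. Qed.
Next Obligation.
by rewrite -vcompA pfC_lwhisk vcompA -pf2_vcomp pfC_lwhisk pf2_vcomp vcompA.
Qed.
Next Obligation.
by rewrite -vcompA pfC_rwhisk vcompA -pf2_vcomp pfC_rwhisk pf2_vcomp vcompA.
Qed.
Next Obligation.
apply: pk_inj; pack.
have H := pfC_lwhisk G (pf1 F h) (pfC F g f); topack H; prw H.
have H1 := f_equal (pf2 G) (pfC_assoc F h g f); topack H1; prw H1.
have H2 := pfC_assoc G (pf1 F h) (pf1 F g) (pf1 F f); topack H2; prw H2.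
by have H3 := pfC_rwhisk G (pfC F h g) (pf1 F f); topack H3; prw H3.
Qed.
Next Obligation.
apply: pk_inj; pack.
have H := pfC_rwhisk G (pfU F y) (pf1 F f); topack H; prw H.
have H1 := f_equal (pf2 G) (pfC_unitl F f); topack H1; prw H1.
by have H2 := pfC_unitl G (pf1 F f); topack H2; prw H2; noeqc.
Qed.
Next Obligation.
apply: pk_inj; pack.
have H := pfC_lwhisk G (pf1 F f) (pfU F x); topack H; prw H.
have H1 := f_equal (pf2 G) (pfC_unitr F f); topack H1; prw H1.
by have H2 := pfC_unitr G (pf1 F f); topack H2; prw H2; noeqc.
Qed.

(** * Pseudonatural transformations *)

(** The structure cell at [f : x -> y] is oriented as [s y ∘ F f => G f ∘ s x]. *)
Record Pseudonat (A B : TwoCat) (F G : Pseudofunctor A B) := {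
  pn0 :> forall x : A, hom (F x) (G x);
  pn1 : forall (x y : A) (f : hom x y), iso2 (pn0 y ∘ pf1 F f) (pf1 G f ∘ pn0 x);
  pn1_nat : forall (x y : A) (f g : hom x y) (a : cell f g),
      pn1 g • (pn0 y ◁ pf2 F a) = (pf2 G a ▷ pn0 x) • pn1 f;
  pn1_comp : forall (x y z : A) (g : hom y z) (f : hom x y),
      pn1 (g ∘ f) • (pn0 z ◁ pfC F g f)
      = (pfC G g f ▷ pn0 x) • idc • (pf1 G g ◁ pn1 f) • idc • (pn1 g ▷ pf1 F f) • idc;
  pn1_unit : forall x : A,
      pn1 (id1 x) • (pn0 x ◁ pfU F x) = (pfU G x ▷ pn0 x) • idc }.

Arguments pn1 {A B F G} _ {x y} _.

Lemma pn_ext (A B : TwoCat) (F G : Pseudofunctor A B) (s t : Pseudonat F G) :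
  (forall x, s x = t x) ->
  (forall (x y : A) (f : hom x y), pk (pn1 s f) = pk (pn1 t f)) -> s = t.
Proof.
case: s => s0 s1 sa sb sc; case: t => t0 t1 ta tb tc /= E0 E1.
have E : s0 = t0 by apply: functional_extensionality_dep.
case: t0 / E t1 ta tb tc {E0} E1 => t1 ta tb tc E1.
have E : s1 = t1.
  do 3 (apply: functional_extensionality_dep=> ?).
  by apply: iso2_ext; apply: pk_inj.
by case: t1 / E ta tb tc E1 => *; f_equal; apply: proof_irrelevance.
Qed.

Program Definition pn_id (A B : TwoCat) (F : Pseudofunctor A B) : Pseudonat F F :=
  {| pn0 := fun x => id1 (F x);
     pn1 := fun x y f =>
       @Iso2 _ _ _ (id1 _ ∘ pf1 F f) (pf1 F f ∘ id1 _) idc idc _ _ |}.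
Solve All Obligations with intros; cbn; apply: pk_inj; pack; noeqc; by [].

Program Definition pn_comp (A B : TwoCat) (F G H : Pseudofunctor A B)
  (t : Pseudonat G H) (s : Pseudonat F G) : Pseudonat F H :=
  {| pn0 := fun x => t x ∘ s x;
     pn1 := fun x y f =>
       @Iso2 _ _ _ (t y ∘ s y ∘ pf1 F f) (pf1 H f ∘ (t x ∘ s x))
         (idc • (pn1 t f ▷ s x) • idc • (t y ◁ pn1 s f) • idc)
         (idc • (t y ◁ bwd (pn1 s f)) • idc • (bwd (pn1 t f) ▷ s x) • idc) _ _ |}.
Next Obligation.
apply: pk_inj; pack; noeqc.
have H1 := f_equal (lwhisk (t y)) (fwd_bwd (pn1 s f)); topack H1; prw H1; noeqc.
have H2 := f_equal (fun a => a ▷ s x) (fwd_bwd (pn1 t f)); topack H2; prw H2; noeqc.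
Qed.
Next Obligation.
apply: pk_inj; pack; noeqc.
have H2 := f_equal (fun a => a ▷ s x) (bwd_fwd (pn1 t f)); topack H2; prw H2; noeqc.
have H1 := f_equal (lwhisk (t y)) (bwd_fwd (pn1 s f)); topack H1; prw H1; noeqc.
Qed.
Next Obligation.
apply: pk_inj; pack; noeqc.
have H1 := f_equal (lwhisk (t y)) (pn1_nat s a); topack H1; prw H1.
by have H2 := f_equal (fun a => a ▷ s x) (pn1_nat t a); topack H2; prw H2.
Qed.
Next Obligation.
apply: pk_inj; pack; noeqc.
have H1 := f_equal (lwhisk (t z)) (pn1_comp s g f); topack H1; prw H1.
have H2 := f_equal (fun a => a ▷ s x) (pn1_comp t g f); topack H2; prw H2.
by have H3 := interchange (pn1 t g) (pn1 s f); topack H3; prw H3.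
Qed.
Next Obligation.
apply: pk_inj; pack; noeqc.
have H1 := f_equal (lwhisk (t x)) (pn1_unit s x); topack H1; prw H1; noeqc.
by have H2 := f_equal (fun a => a ▷ s x) (pn1_unit t x); topack H2; prw H2; noeqc.
Qed.

(** The whiskerings [K s] and [s F]. *)

Program Definition pn_rwhisk (A B C : TwoCat) (G H : Pseudofunctor B C)
  (s : Pseudonat G H) (F : Pseudofunctor A B) : Pseudonat (pf_comp G F) (pf_comp H F) :=
  {| pn0 := fun x => s (F x); pn1 := fun x y f => pn1 s (pf1 F f) |}.
Next Obligation. exact: pn1_nat. Qed.
Next Obligation.
apply: pk_inj; pack; noeqc.
have H1 := pn1_nat s (pfC F g f); topack H1; prw H1.
by have H2 := pn1_comp s (pf1 F g) (pf1 F f); topack H2; prw H2.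
Qed.
Next Obligation.
apply: pk_inj; pack; noeqc.
have H1 := pn1_nat s (pfU F x); topack H1; prw H1.
by have H2 := pn1_unit s (F x); topack H2; prw H2; noeqc.
Qed.

Lemma fwd_inj (C : TwoCat) (A B : C) (f g h : hom A B) (i : iso2 f g) (a b : cell h f) :
  fwd i • a = fwd i • b -> a = b.
Proof.
by move=> E; rewrite -(vcomp1c a) -(vcomp1c b) -(bwd_fwd i) -!vcompA E.
Qed.

Program Definition pn_lwhisk (A B C : TwoCat) (K : Pseudofunctor B C)
  (F G : Pseudofunctor A B) (s : Pseudonat F G) : Pseudonat (pf_comp K F) (pf_comp K G) :=
  {| pn0 := fun x => pf1 K (s x);
     pn1 := fun x y f =>
       @Iso2 _ _ _ (pf1 K (s y) ∘ pf1 K (pf1 F f)) (pf1 K (pf1 G f) ∘ pf1 K (s x))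
         (bwd (pfC K (pf1 G f) (s x)) • pf2 K (pn1 s f) • pfC K (s y) (pf1 F f))
         (bwd (pfC K (s y) (pf1 F f)) • pf2 K (bwd (pn1 s f)) • pfC K (pf1 G f) (s x))
         _ _ |}.
Next Obligation.
rewrite -!vcompA (vcompA (pfC K _ _)) fwd_bwd vcomp1c (vcompA (pf2 K _)) -pf2_vcomp.
by rewrite fwd_bwd pf2_id vcomp1c bwd_fwd.
Qed.
Next Obligation.
rewrite -!vcompA (vcompA (pfC K _ _)) fwd_bwd vcomp1c (vcompA (pf2 K _)) -pf2_vcomp.
by rewrite bwd_fwd pf2_id vcomp1c bwd_fwd.
Qed.
Next Obligation.
apply: (fwd_inj (i := pfC K _ _)); rewrite -!vcompA pfC_lwhisk.
rewrite !(vcompA (pfC K _ _) (_ ▷ _)) pfC_rwhisk !(vcompA (pfC K _ _) (bwd _)).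
rewrite -!vcompA !(vcompA (pfC K _ _) (bwd _)) !fwd_bwd !vcomp1c !vcompA -!pf2_vcomp.
by rewrite pn1_nat.
Qed.
Next Obligation.
apply: (fwd_inj (i := pfC K _ _)).
apply: pk_inj; pack; noeqc.
have H0 := fwd_bwd (pfC K (pf1 G (g ∘ f)) (s x)); topack H0; prw H0; noeqc.
have H1 := pfC_lwhisk K (s z) (pfC F g f); topack H1; prw H1.
have H2 := f_equal (pf2 K) (pn1_comp s g f); topack H2; prw H2.
have H3 := pfC_assoc K (s z) (pf1 F g) (pf1 F f); topack H3; prw H3.
have H4 := pfC_rwhisk K (pn1 s g) (pf1 F f); topack H4; prw (esym H4).
have H5 := pfC_rwhisk K (pfC G g f) (s x); topack H5; prw H5.
have H6 := pfC_assoc K (pf1 G g) (pf1 G f) (s x); topack H6; prw (esym H6).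
have H7 := f_equal (lwhisk (pf1 K (pf1 G g))) (fwd_bwd (pfC K (pf1 G f) (s x))).
topack H7; prw H7; noeqc.
have H8 := pfC_lwhisk K (pf1 G g) (pn1 s f); topack H8; prw H8.
have H9 := pfC_assoc K (pf1 G g) (s y) (pf1 F f); topack H9; prw H9.
have H10 := f_equal (fun a => a ▷ pf1 K (pf1 F f)) (fwd_bwd (pfC K (pf1 G g) (s y))).
by topack H10; prw H10; noeqc.
Qed.
Next Obligation.
apply: (fwd_inj (i := pfC K _ _)).
apply: pk_inj; pack; noeqc.
have H0 := fwd_bwd (pfC K (pf1 G (id1 x)) (s x)); topack H0; prw H0; noeqc.
have H1 := pfC_lwhisk K (s x) (pfU F x); topack H1; prw H1.
have H2 := f_equal (pf2 K) (pn1_unit s x); topack H2; prw H2.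
have H3 := pfC_rwhisk K (pfU G x) (s x); topack H3; prw H3.
have H4 := pfC_unitr K (s x); topack H4.
have H5 := pfC_unitl K (s x); topack H5.
by prw H4; prw H5; noeqc.
Qed.

(** Composition of pseudofunctors is strictly associative and unital, but not
    judgmentally so; the next three operations re-type a transformation along these
    equalities, keeping its components. *)

Program Definition pn_src_assoc (A B C D : TwoCat) (H : Pseudofunctor C D)
  (G : Pseudofunctor B C) (F : Pseudofunctor A B) (K : Pseudofunctor A D)
  (s : Pseudonat (pf_comp (pf_comp H G) F) K) : Pseudonat (pf_comp H (pf_comp G F)) K :=
  {| pn0 := fun x => s x; pn1 := fun x y f => pn1 s f |}.
Next Obligation. exact: (pn1_nat s). Qed.
Next Obligation. by move: (pn1_comp s g f); rewrite /= pf2_vcomp -vcompA. Qed.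
Next Obligation. by move: (pn1_unit s x); rewrite /= pf2_vcomp -vcompA. Qed.

Program Definition pn_src_unitl (A B : TwoCat) (F G : Pseudofunctor A B)
  (s : Pseudonat (pf_comp (pf_id B) F) G) : Pseudonat F G :=
  {| pn0 := fun x => s x; pn1 := fun x y f => pn1 s f |}.
Next Obligation. exact: (pn1_nat s). Qed.
Next Obligation. by move: (pn1_comp s g f); rewrite /= vcompc1. Qed.
Next Obligation. by move: (pn1_unit s x); rewrite /= vcompc1. Qed.

Program Definition pn_src_unitr (A B : TwoCat) (F G : Pseudofunctor A B)
  (s : Pseudonat (pf_comp F (pf_id A)) G) : Pseudonat F G :=
  {| pn0 := fun x => s x; pn1 := fun x y f => pn1 s f |}.
Next Obligation. exact: (pn1_nat s). Qed.
Next Obligation. by move: (pn1_comp s g f); rewrite /= pf2_id vcomp1c. Qed.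
Next Obligation. by move: (pn1_unit s x); rewrite /= pf2_id vcomp1c. Qed.
(** * Modifications and the 2-category [Ps A B] *)

Record Modification (A B : TwoCat) (F G : Pseudofunctor A B) (s t : Pseudonat F G) := {
  mod0 :> forall x : A, cell (s x) (t x);
  mod_nat : forall (x y : A) (f : hom x y),
      (pf1 G f ◁ mod0 x) • pn1 s f = pn1 t f • (mod0 y ▷ pf1 F f) }.

Lemma mod_ext (A B : TwoCat) (F G : Pseudofunctor A B) (s t : Pseudonat F G)
  (m n : Modification s t) : (forall x, m x = n x) -> m = n.
Proof.
case: m => m0 m1; case: n => n0 n1 /= E0.
have E : m0 = n0 by apply: functional_extensionality_dep.
by case: n0 / E n1 {E0} => n1; f_equal; apply: proof_irrelevance.
Qed.

Section Ps.
Context {A B : TwoCat}.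

Program Definition mod_id (F G : Pseudofunctor A B) (s : Pseudonat F G) :
  Modification s s := {| mod0 := fun x => id2 (s x) |}.
Next Obligation. by rewrite lwhisk_id rwhisk_id vcomp1c vcompc1. Qed.

Program Definition mod_vcomp (F G : Pseudofunctor A B) (s t u : Pseudonat F G)
  (n : Modification t u) (m : Modification s t) : Modification s u :=
  {| mod0 := fun x => n x • m x |}.
Next Obligation.
by rewrite lwhisk_vcomp rwhisk_vcomp -vcompA mod_nat vcompA mod_nat vcompA.
Qed.

Program Definition mod_lwhisk (F G H : Pseudofunctor A B) (t : Pseudonat G H)
  (s s' : Pseudonat F G) (m : Modification s s') :
  Modification (pn_comp t s) (pn_comp t s') := {| mod0 := fun x => t x ◁ m x |}.
Next Obligation.
apply: pk_inj; pack; noeqc.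
have H1 := interchange (pn1 t f) (m x); topack H1; prw (esym H1).
by have H2 := f_equal (lwhisk (t y)) (mod_nat m f); topack H2; prw H2.
Qed.

Program Definition mod_rwhisk (F G H : Pseudofunctor A B) (t t' : Pseudonat G H)
  (m : Modification t t') (s : Pseudonat F G) :
  Modification (pn_comp t s) (pn_comp t' s) := {| mod0 := fun x => m x ▷ s x |}.
Next Obligation.
apply: pk_inj; pack; noeqc.
have H2 := f_equal (fun a => a ▷ s x) (mod_nat m f); topack H2; prw H2.
by have H1 := interchange (m y) (pn1 s f); topack H1; prw H1.
Qed.

Definition PsData : TwoCatData := {|
  ob := Pseudofunctor A B;
  hom := @Pseudonat A B;
  cell := @Modification A B;
  id1 := @pn_id A B;
  comp1 := @pn_comp A B;
  id2 := mod_id;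
  vcomp := mod_vcomp;
  lwhisk := mod_lwhisk;
  rwhisk := mod_rwhisk |}.

Lemma pk_mod_eqcl (F G : PsData) (s t u : hom F G) (e : t = u) (m : cell s t) x :
  pk (mod0 (eqc e • m) x) = pk (mod0 m x).
Proof. by case: u / e; rewrite /= vcomp1c. Qed.
Lemma pk_mod_eqcr (F G : PsData) (s t u : hom F G) (e : u = s) (m : cell s t) x :
  pk (mod0 (m • eqc e) x) = pk (mod0 m x).
Proof. by move: m; case: s / e => m; rewrite /= vcompc1. Qed.
End Ps.

Program Definition Ps (A B : TwoCat) : TwoCat := {| tcdata := @PsData A B |}.
Next Obligation. by apply: mod_ext => x /=; rewrite vcompA. Qed.
Next Obligation. by apply: mod_ext => x /=; rewrite vcomp1c. Qed.
Next Obligation. by apply: mod_ext => x /=; rewrite vcompc1. Qed.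
Next Obligation. by apply: mod_ext => x /=; rewrite lwhisk_id. Qed.
Next Obligation. by apply: mod_ext => x /=; rewrite lwhisk_vcomp. Qed.
Next Obligation. by apply: mod_ext => x /=; rewrite rwhisk_id. Qed.
Next Obligation. by apply: mod_ext => x /=; rewrite rwhisk_vcomp. Qed.
Next Obligation. by apply: mod_ext => x /=; rewrite interchange. Qed.
Next Obligation.
apply: pn_ext => [x|x y k] /=; first exact: comp1A.
by pack; noeqc.
Qed.
Next Obligation.
apply: pn_ext => [x|x y k] /=; first exact: comp11f.
by pack; noeqc.
Qed.
Next Obligation.
apply: pn_ext => [x|x y k] /=; first exact: comp1f1.
by pack; noeqc.
Qed.
Next Obligation.
apply: mod_ext => x; apply: pk_inj; rewrite pk_mod_eqcl pk_mod_eqcr /=.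
by pack.
Qed.
Next Obligation.
apply: mod_ext => x; apply: pk_inj; rewrite pk_mod_eqcl pk_mod_eqcr /=.
by pack.
Qed.
Next Obligation.
apply: mod_ext => x; apply: pk_inj; rewrite pk_mod_eqcl pk_mod_eqcr /=.
by pack.
Qed.
Next Obligation.
apply: mod_ext => x; apply: pk_inj; rewrite pk_mod_eqcl pk_mod_eqcr /=.
by pack.
Qed.
Next Obligation.
apply: mod_ext => x; apply: pk_inj; rewrite pk_mod_eqcl pk_mod_eqcr /=.
by pack.
Qed.

(** * Adjunctions in a 2-category, pseudomonads *)

(** [e] is the counit of an adjunction [l ⊣ r] in [K]. *)
Definition is_counit (K : TwoCat) (A B : K) (l : hom A B) (r : hom B A)
    (e : cell (l ∘ r) (id1 B)) : Prop :=
  exists u : cell (id1 A) (r ∘ l),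
    (e ▷ l) • idc • (l ◁ u) = (idc : cell (l ∘ id1 A) (id1 B ∘ l)) /\
    (r ◁ e) • idc • (u ▷ r) = (idc : cell (id1 A ∘ r) (r ∘ id1 B)).

(** The action of a pseudofunctor on a 2-cell between composites, conjugated by the
    structure isomorphisms. *)
Definition pf2sq {A B : TwoCat} (F : Pseudofunctor A B) {x y y' z : A}
    {g : hom y z} {f : hom x y} {g' : hom y' z} {f' : hom x y'}
    (a : cell (g ∘ f) (g' ∘ f')) : cell (pf1 F g ∘ pf1 F f) (pf1 F g' ∘ pf1 F f') :=
  bwd (pfC F g' f') • pf2 F a • pfC F g f.

Definition pf2un {A B : TwoCat} (F : Pseudofunctor A B) {x y : A}
    {g : hom y x} {f : hom x y} (a : cell (g ∘ f) (id1 x)) :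
    cell (pf1 F g ∘ pf1 F f) (id1 (F x)) :=
  bwd (pfU F x) • pf2 F a • pfC F g f.

Record PseudomonadData (C : TwoCat) := {
  pmT :> Pseudofunctor C C;
  mu : Pseudonat (pf_comp pmT pmT) pmT;
  eta : Pseudonat (pf_id C) pmT }.

Arguments mu {C} _.
Arguments eta {C} _.

Section Whiskers.
Context {C : TwoCat} (T : PseudomonadData C).
Definition T_mu : Pseudonat (pf_comp T (pf_comp T T)) (pf_comp T T) :=
  pn_lwhisk T (mu T).
Definition mu_T : Pseudonat (pf_comp T (pf_comp T T)) (pf_comp T T) :=
  pn_src_assoc (pn_rwhisk (mu T) T).
Definition eta_T : Pseudonat T (pf_comp T T) := pn_src_unitl (pn_rwhisk (eta T) T).
Definition T_eta : Pseudonat T (pf_comp T T) := pn_src_unitr (pn_lwhisk T (eta T)).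
End Whiskers.

(** [alpha], [lambda], [rho] are invertible 2-cells of [Ps C C], that is, invertible
    modifications.  [pm_assoc] and [pm_unit] are the usual two coherence equations
    between modifications, written at each component; the further unit equations for
    a pseudomonad are consequences of these two. *)
Record Pseudomonad (C : TwoCat) := {
  pmdata :> PseudomonadData C;
  alpha : @iso2 (Ps C C) _ _ (pn_comp (mu pmdata) (T_mu pmdata))
                             (pn_comp (mu pmdata) (mu_T pmdata));
  lambda : @iso2 (Ps C C) _ _ (pn_comp (mu pmdata) (eta_T pmdata)) (pn_id pmdata);
  rho : @iso2 (Ps C C) _ _ (pn_id pmdata) (pn_comp (mu pmdata) (T_eta pmdata));
  pm_assoc : forall (T := pmdata) (m := mu T) (x : C)
      (a := fun y => mod0 (fwd alpha) y : cell (m y ∘ pf1 T (m y)) (m y ∘ m (T y))),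
      (m x ◁ a (T x)) • idc • (a x ▷ pf1 T (m (T x))) • idc • (m x ◁ pf2sq T (a x))
      = idc • (a x ▷ m (T (T x))) • idc • (m x ◁ pn1 m (m x)) • idc
        • (a x ▷ pf1 T (pf1 T (m x))) • idc;
  pm_unit : forall (T := pmdata) (m := mu T) (e := eta T) (x : C)
      (a := fun y => mod0 (fwd alpha) y : cell (m y ∘ pf1 T (m y)) (m y ∘ m (T y)))
      (l := fun y => mod0 (fwd lambda) y : cell (m y ∘ e (T y)) (id1 (T y)))
      (r := fun y => mod0 (fwd rho) y : cell (id1 (T y)) (m y ∘ pf1 T (e y))),
      (a x ▷ pf1 T (e (T x))) • idc
      = idc • (m x ◁ r (T x)) • (m x ◁ pf2un T (l x)) }.

Definition lax_idempotent (C : TwoCat) (T : Pseudomonad C) : Prop :=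
  @is_counit (Ps C C) _ _ (mu T) (eta_T T) (fwd (lambda T)).

(** * Pseudoalgebras *)

(** As for pseudomonads, the second unit equation follows from the two equations
    required here. *)
Record PsAlg (C : TwoCat) (T : Pseudomonad C) := {
  pa0 : C;
  act : hom (T pa0) pa0;
  act_mult : iso2 (act ∘ pf1 T act) (act ∘ mu T pa0);
  act_unit : iso2 (act ∘ eta T pa0) (id1 pa0);
  act_assoc :
      (act ◁ mod0 (fwd (alpha T)) pa0) • idc • (act_mult ▷ pf1 T (mu T pa0)) • idc
        • (act ◁ pf2sq T act_mult)
      = idc • (act_mult ▷ mu T (T pa0)) • idc • (act ◁ pn1 (mu T) act) • idc
        • (act_mult ▷ pf1 T (pf1 T act)) • idc;
  act_unital :
      (act_mult ▷ pf1 T (eta T pa0)) • idc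
      = idc • (act ◁ mod0 (fwd (rho T)) pa0) • (act ◁ pf2un T act_unit) }.

Arguments act {C T} _.
Arguments act_mult {C T} _.
Arguments act_unit {C T} _.

Record PsMor (C : TwoCat) (T : Pseudomonad C) (A B : PsAlg T) := {
  pm0 : hom (pa0 A) (pa0 B);
  pm1 : iso2 (act B ∘ pf1 T pm0) (pm0 ∘ act A);
  pm1_mult :
      (pm0 ◁ act_mult A) • idc • (pm1 ▷ pf1 T (act A)) • idc • (act B ◁ pf2sq T pm1)
      = idc • (pm1 ▷ mu T (pa0 A)) • idc • (act B ◁ pn1 (mu T) pm0) • idc
        • (act_mult B ▷ pf1 T (pf1 T pm0)) • idc;
  pm1_unit :
      (pm0 ◁ act_unit A) • idc • (pm1 ▷ eta T (pa0 A)) • idc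
        • (act B ◁ pn1 (eta T) pm0)
      = idc • (act_unit B ▷ pm0) • idc }.

Arguments pm0 {C T A B} _.
Arguments pm1 {C T A B} _.

(** Algebra 2-cells. *)
Record PsAlgCell (C : TwoCat) (T : Pseudomonad C) (A B : PsAlg T) (f g : PsMor A B) := {
  ac0 : cell (pm0 f) (pm0 g);
  ac_nat : (ac0 ▷ act A) • pm1 f = pm1 g • (act B ◁ pf2 T ac0) }.

Arguments ac0 {C T A B f g} _.

Lemma pm_ext (C : TwoCat) (T : Pseudomonad C) (A B : PsAlg T) (f g : PsMor A B) :
  pm0 f = pm0 g -> pk (pm1 f) = pk (pm1 g) -> f = g.
Proof.
case: f => f0 f1 fa fb; case: g => g0 g1 ga gb /= E.
case: g0 / E g1 ga gb => g1 ga gb E.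
have {}E : f1 = g1 by apply: iso2_ext; apply: pk_inj.
by case: g1 / E ga gb => *; f_equal; apply: proof_irrelevance.
Qed.

Lemma ac_ext (C : TwoCat) (T : Pseudomonad C) (A B : PsAlg T) (f g : PsMor A B)
  (a b : PsAlgCell f g) : ac0 a = ac0 b -> a = b.
Proof.
case: a => a0 a1; case: b => b0 b1 /= E; case: b0 / E b1 => *.
by f_equal; apply: proof_irrelevance.
Qed.

Lemma pl_pc (C : TwoCat) (A B D : C) (g : hom B D) f (y x : pcell A B) :
  Tgt x f -> Src y f -> pl g (pc y x) = pc (pl g y) (pl g x).
Proof.
case: y => [[f1 [h b]]|]; case: x => [[f2 [h' a]]|] //= E1 E2; subst.
change (pl g (pc (pk b) (pk a)) = pc (pk (g ◁ b)) (pk (g ◁ a))).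
by rewrite -!pk_vcomp -lwhisk_vcomp.
Qed.

Lemma pl_id (C : TwoCat) (A B D : C) (g : hom B D) (f : hom A B) :
  pl g (pk (id2 f)) = pk (id2 (g ∘ f)).
Proof. by rewrite -pk_lwhisk lwhisk_id. Qed.

Ltac pushl H := repeat (erewrite pl_pc in H; [|repeat apply Tgt_pc; cbn; reflexivity|strict]);
  rewrite ?pl_id ?pl_pl ?pr_pl -?pcA ?comp1A in H.

Section Inverses.
Context {A B : TwoCat} (F : Pseudofunctor A B).

Lemma pfC_lwhisk_inv (x y z : A) (g : hom y z) (f f' : hom x y) (a : cell f f') :
  bwd (pfC F g f') • pf2 F (g ◁ a) = (pf1 F g ◁ pf2 F a) • bwd (pfC F g f).
Proof.
apply: (fwd_inj (i := pfC F _ _)).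
by rewrite !vcompA fwd_bwd vcomp1c pfC_lwhisk -vcompA fwd_bwd vcompc1.
Qed.
Lemma pfC_rwhisk_inv (x y z : A) (g g' : hom y z) (b : cell g g') (f : hom x y) :
  bwd (pfC F g' f) • pf2 F (b ▷ f) = (pf2 F b ▷ pf1 F f) • bwd (pfC F g f).
Proof.
apply: (fwd_inj (i := pfC F _ _)).
by rewrite !vcompA fwd_bwd vcomp1c pfC_rwhisk -vcompA fwd_bwd vcompc1.
Qed.

Lemma pfC_assoc_inv (w x y z : A) (h : hom y z) (g : hom x y) (f : hom w x) :
  pc (pl (pf1 F h) (pk (bwd (pfC F g f)))) (pk (bwd (pfC F h (g ∘ f))))
  = pc (pr (pk (bwd (pfC F h g))) (pf1 F f)) (pk (bwd (pfC F (h ∘ g) f))).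
Proof.
have H := pfC_assoc F h g f; topack H.
set P := LHS; set Q := RHS.
have {}H : pc P (pc (pk (pfC F h (g ∘ f))) (pc (pl (pf1 F h) (pk (pfC F g f))) Q))
   = pc P (pc (pk (pfC F (h ∘ g) f)) (pc (pr (pk (pfC F h g)) (pf1 F f)) Q)).
  by rewrite (pcA _ (pl _ _) Q) (pcA _ (pr _ _) Q) H.
have H1 := f_equal (lwhisk (pf1 F h)) (bwd_fwd (pfC F g f)); topack H1.
have H2 := bwd_fwd (pfC F h (g ∘ f)); topack H2.
have H3 := f_equal (fun a => a ▷ pf1 F f) (fwd_bwd (pfC F h g)); topack H3.
have H4 := fwd_bwd (pfC F (h ∘ g) f); topack H4.
move: H; rewrite /P /Q -!pcA.
prw H2; noeqc; prw H1; noeqc; prw H3; noeqc; prw H4; noeqc.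
by move=> ->.
Qed.

Lemma pfC_unitl_inv (x y : A) (f : hom x y) :
  pc (pr (pk (bwd (pfU F y))) (pf1 F f)) (pk (bwd (pfC F (id1 y) f)))
  = pk (id2 (pf1 F f)).
Proof.
have H := pfC_unitl F f; topack H.
have H1 := f_equal (fun a => a ▷ pf1 F f) (bwd_fwd (pfU F y)); topack H1.
have H2 := bwd_fwd (pfC F (id1 y) f); topack H2.
set X := LHS.
have E : X = pc X (pc (pk (pfC F (id1 y) f)) (pr (pk (pfU F y)) (pf1 F f))).
  by rewrite H /X; noeqc.
by rewrite E /X; pnorm; prw H2; noeqc; prw H1; noeqc.
Qed.

Lemma pfC_unitr_inv (x y : A) (f : hom x y) :
  pc (pl (pf1 F f) (pk (bwd (pfU F x)))) (pk (bwd (pfC F f (id1 x))))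
  = pk (id2 (pf1 F f)).
Proof.
have H := pfC_unitr F f; topack H.
have H1 := f_equal (lwhisk (pf1 F f)) (bwd_fwd (pfU F x)); topack H1.
have H2 := bwd_fwd (pfC F f (id1 x)); topack H2.
set X := LHS.
have E : X = pc X (pc (pk (pfC F f (id1 x))) (pl (pf1 F f) (pk (pfU F x)))).
  by rewrite H /X; noeqc.
by rewrite E /X; pnorm; prw H2; noeqc; prw H1; noeqc.
Qed.

Lemma pf2sq_rcomp (x y y' z : A) (g : hom y z) (f f1 : hom x y) (g' : hom y' z)
  (f' : hom x y') (a : cell (g ∘ f) (g' ∘ f')) (d : cell f1 f) :
  pf2sq F (a • (g ◁ d)) = pf2sq F a • (pf1 F g ◁ pf2 F d).
Proof. by rewrite /pf2sq pf2_vcomp -!vcompA pfC_lwhisk. Qed.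

Lemma pf2sq_paste (x y z x' y' z' : A) (f : hom x y) (g : hom y z)
  (f' : hom x' y') (g' : hom y' z') (a : hom x' x) (b : hom y' y) (c : hom z' z)
  (sf : cell (b ∘ f') (f ∘ a)) (sg : cell (c ∘ g') (g ∘ b))
  (s : cell (c ∘ (g' ∘ f')) ((g ∘ f) ∘ a)) :
  pk s = pk (idc • (g ◁ sf) • idc • (sg ▷ f') • idc
             : cell (c ∘ (g' ∘ f')) ((g ∘ f) ∘ a)) ->
  idc • (bwd (pfC F g f) ▷ pf1 F a) • pf2sq F s • (pf1 F c ◁ pfC F g' f')
  = (pf1 F g ◁ pf2sq F sf) • idc • (pf2sq F sg ▷ pf1 F f') • idc.
Proof.
move=> /pk_inj ->; apply: pk_inj; rewrite /pf2sq; pack.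
have H1 := pfC_assoc F c g' f'; topack H1; prw H1.
have H2 := pfC_rwhisk F sg f'; topack H2; prw (esym H2).
have H3 := pfC_assoc F g b f'; topack H3.
have H4 := f_equal (fun a => a ▷ pf1 F f') (fwd_bwd (pfC F g b)); topack H4.
have H5 : pc (pk (pfC F g (b ∘ f'))) (pc (pl (pf1 F g) (pk (pfC F b f')))
            (pr (pk (bwd (pfC F g b))) (pf1 F f'))) = pk (pfC F (g ∘ b) f').
  by prw H3; prw H4; noeqc.
rewrite -H5 -!pcA; prw (esym (pfC_assoc_inv g f a)).
have H6 := pfC_lwhisk_inv g sf; topack H6; prw H6.
by have H7 := bwd_fwd (pfC F g (b ∘ f')); topack H7; prw H7; noeqc.
Qed.

Lemma pf2sq_1 (x y : A) (a : hom x y) (e : a ∘ id1 x = id1 y ∘ a) :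
  (bwd (pfU F y) ▷ pf1 F a) • pf2sq F (eqc e) • (pf1 F a ◁ pfU F x) = idc.
Proof.
apply: pk_inj; rewrite /pf2sq; pack.
have H := pfC_unitr F a; topack H; prw H; noeqc.
by prw (pfC_unitl_inv a); noeqc.
Qed.

End Inverses.

Lemma fwd_injr (C : TwoCat) (A B : C) (f g h : hom A B) (i : iso2 f g) (a b : cell g h) :
  a • fwd i = b • fwd i -> a = b.
Proof.
by move=> E; rewrite -(vcompc1 a) -(vcompc1 b) -(fwd_bwd i) !vcompA E.
Qed.

Program Definition iso_lwhisk (C : TwoCat) (X Y Z : C) (g : hom Y Z) (f f' : hom X Y)
  (i : iso2 f f') : iso2 (g ∘ f) (g ∘ f') := @Iso2 _ _ _ (g ∘ f) (g ∘ f') (g ◁ i) (g ◁ bwd i) _ _.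
Next Obligation. by rewrite -lwhisk_vcomp fwd_bwd lwhisk_id. Qed.
Next Obligation. by rewrite -lwhisk_vcomp bwd_fwd lwhisk_id. Qed.

(** * The 2-category of pseudoalgebras *)

#[local] Opaque pf2sq.

Section PsAlg.
Context {C : TwoCat} (T : Pseudomonad C).

Program Definition pm_id (A : PsAlg T) : PsMor A A :=
  {| pm0 := id1 (pa0 A);
     pm1 := @Iso2 _ _ _ (act A ∘ pf1 T (id1 (pa0 A))) (id1 (pa0 A) ∘ act A)
       (idc • (act A ◁ bwd (pfU T (pa0 A))))
       ((act A ◁ pfU T (pa0 A)) • idc) _ _ |}.
Next Obligation.
apply: pk_inj; pack; noeqc.
by have H := f_equal (lwhisk (act A)) (bwd_fwd (pfU T (pa0 A))); topack H; prw H; noeqc.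
Qed.
Next Obligation.
apply: pk_inj; pack; noeqc.
by have H := f_equal (lwhisk (act A)) (fwd_bwd (pfU T (pa0 A))); topack H; prw H; noeqc.
Qed.
Next Obligation.
rewrite pf2sq_rcomp.
apply: (fwd_injr (i := iso_lwhisk (act A) (iso_lwhisk (pf1 T (act A))
          (pfU (pf_comp T T) (pa0 A))))).
cbn; apply: pk_inj; pack; noeqc.
have H1 := f_equal (fun b => act A ◁ (pf1 T (act A) ◁ pf2 T b)) (bwd_fwd (pfU T (pa0 A))).
topack H1; prw H1; noeqc.
have H2 := interchange (act_mult A) (pf2 T (pfU T (pa0 A)) • pfU T (T (pa0 A))).
topack H2; prw H2.
have H3 := f_equal (lwhisk (act A)) (pn1_unit (mu T) (pa0 A)); topack H3; prw H3; noeqc.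
have H4 := f_equal (fun b => act A ◁ (b ▷ mu T (pa0 A))) (bwd_fwd (pfU T (pa0 A))).
topack H4; prw H4; noeqc.
match goal with |- context [pf2sq _ (@eqc _ _ _ _ _ ?e)] =>
  have H5 := f_equal (lwhisk (act A)) (pf2sq_1 T e) end.
by topack H5; prw H5; noeqc.
Qed.
Next Obligation.
apply: pk_inj; pack; noeqc.
have H1 := f_equal (lwhisk (act A)) (pn1_unit (eta T) (pa0 A)); topack H1.
prw H1.
have H2 := f_equal (fun b => act A ◁ (b ▷ eta T (pa0 A))) (bwd_fwd (pfU T (pa0 A))).
by topack H2; prw H2; noeqc.
Qed.

Program Definition pm_comp (X Y Z : PsAlg T) (g : PsMor Y Z) (f : PsMor X Y) : PsMor X Z :=
  {| pm0 := pm0 g ∘ pm0 f;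
     pm1 := @Iso2 _ _ _ (act Z ∘ pf1 T (pm0 g ∘ pm0 f)) (pm0 g ∘ pm0 f ∘ act X)
       (idc • (pm0 g ◁ pm1 f) • idc • (pm1 g ▷ pf1 T (pm0 f)) • idc
         • (act Z ◁ bwd (pfC T (pm0 g) (pm0 f))))
       ((act Z ◁ pfC T (pm0 g) (pm0 f)) • idc • (bwd (pm1 g) ▷ pf1 T (pm0 f)) • idc
         • (pm0 g ◁ bwd (pm1 f)) • idc) _ _ |}.
Next Obligation.
apply: pk_inj; pack; noeqc.
have H := f_equal (lwhisk (act Z)) (bwd_fwd (pfC T (pm0 g) (pm0 f))); topack H; prw H; noeqc.
have H1 := f_equal (fun a => a ▷ pf1 T (pm0 f)) (fwd_bwd (pm1 g)); topack H1; prw H1; noeqc.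
by have H2 := f_equal (lwhisk (pm0 g)) (fwd_bwd (pm1 f)); topack H2; prw H2; noeqc.
Qed.
Next Obligation.
apply: pk_inj; pack; noeqc.
have H2 := f_equal (lwhisk (pm0 g)) (bwd_fwd (pm1 f)); topack H2; prw H2; noeqc.
have H1 := f_equal (fun a => a ▷ pf1 T (pm0 f)) (bwd_fwd (pm1 g)); topack H1; prw H1; noeqc.
by have H := f_equal (lwhisk (act Z)) (fwd_bwd (pfC T (pm0 g) (pm0 f))); topack H; prw H; noeqc.
Qed.
Next Obligation.
pose (s := idc • (pm0 g ◁ pm1 f) • idc • (pm1 g ▷ pf1 T (pm0 f)) • idc
  : cell (act Z ∘ (pf1 T (pm0 g) ∘ pf1 T (pm0 f))) ((pm0 g ∘ pm0 f) ∘ act X)).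
rewrite [pf2sq T (idc • _)]
  (_ : _ = pf2sq T s • (pf1 T (act Z) ◁ pf2 T (bwd (pfC T (pm0 g) (pm0 f))))).
  rewrite -pf2sq_rcomp /s; congr (pf2sq T _).
  by apply: pk_inj; pack; noeqc.
have P := pf2sq_paste T (sf := pm1 f) (sg := pm1 g) (s := s).
have {}P := P ltac:(by rewrite /s; pack; noeqc).
have Lf := pm1_mult f; have Lg := pm1_mult g.
move: (pf2sq T s) (pf2sq T (pm1 f)) (pf2sq T (pm1 g)) P Lf Lg => ts tf tg P Lf Lg.
apply: (fwd_injr (i := iso_lwhisk (act Z) (iso_lwhisk (pf1 T (act Z))
          (pfC (pf_comp T T) (pm0 g) (pm0 f))))).
cbn; apply: pk_inj; pack; noeqc.
have H1 := f_equal (fun b => act Z ◁ (pf1 T (act Z) ◁ pf2 T b))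
  (bwd_fwd (pfC T (pm0 g) (pm0 f))).
topack H1; prw H1; noeqc.
have {}P := f_equal (lwhisk (act Z)) P; topack P; prw P.
have H2 := interchange (pm1 g) tf; topack H2; prw H2.
have {}Lf := f_equal (lwhisk (pm0 g)) Lf; topack Lf; prw Lf.
have {}Lg := f_equal (fun b => b ▷ pf1 T (pf1 T (pm0 f))) Lg; topack Lg; prw Lg.
have H3 := interchange (pm1 g) (pn1 (mu T) (pm0 f)); topack H3; prw (esym H3).
have H4 := interchange (act_mult Z)
  (pf2 T (pfC T (pm0 g) (pm0 f)) • pfC T (pf1 T (pm0 g)) (pf1 T (pm0 f))).
topack H4; prw H4.
have H5 := f_equal (lwhisk (act Z)) (pn1_comp (mu T) (pm0 g) (pm0 f)); topack H5; prw H5.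
have H6 := f_equal (fun b => act Z ◁ (b ▷ mu T (pa0 X))) (bwd_fwd (pfC T (pm0 g) (pm0 f))).
by topack H6; prw H6; noeqc.
Qed.
Next Obligation.
apply: pk_inj; pack; noeqc.
have H := f_equal (lwhisk (act Z)) (pn1_comp (eta T) (pm0 g) (pm0 f)); topack H.
prw H.
have H1 := f_equal (fun b => act Z ◁ (b ▷ eta T (pa0 X))) (bwd_fwd (pfC T (pm0 g) (pm0 f))).
topack H1; prw H1; noeqc.
have H2 := interchange (pm1 g) (pn1 (eta T) (pm0 f)); topack H2; prw H2.
have H3 := f_equal (lwhisk (pm0 g)) (pm1_unit f); topack H3; prw H3.
by have H4 := f_equal (fun b => b ▷ pm0 f) (pm1_unit g); topack H4; prw H4.
Qed.

Program Definition ac_id (A B : PsAlg T) (f : PsMor A B) : PsAlgCell f f :=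
  {| ac0 := id2 (pm0 f) |}.
Next Obligation. by rewrite pf2_id lwhisk_id rwhisk_id vcomp1c vcompc1. Qed.

Program Definition ac_vcomp (A B : PsAlg T) (f g h : PsMor A B)
  (b : PsAlgCell g h) (a : PsAlgCell f g) : PsAlgCell f h :=
  {| ac0 := ac0 b • ac0 a |}.
Next Obligation.
by rewrite rwhisk_vcomp -vcompA ac_nat vcompA ac_nat pf2_vcomp lwhisk_vcomp vcompA.
Qed.

Program Definition ac_lwhisk (X Y Z : PsAlg T) (g : PsMor Y Z) (f f' : PsMor X Y)
  (a : PsAlgCell f f') : PsAlgCell (pm_comp g f) (pm_comp g f') :=
  {| ac0 := pm0 g ◁ ac0 a |}.
Next Obligation.
apply: pk_inj; pack; noeqc.
have H := f_equal (lwhisk (act Z)) (pfC_lwhisk_inv T (pm0 g) (ac0 a)); topack H; prw H.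
have H1 := interchange (pm1 g) (pf2 T (ac0 a)); topack H1; prw H1.
by have H2 := f_equal (lwhisk (pm0 g)) (ac_nat a); topack H2; prw H2.
Qed.

Program Definition ac_rwhisk (X Y Z : PsAlg T) (g g' : PsMor Y Z)
  (a : PsAlgCell g g') (f : PsMor X Y) : PsAlgCell (pm_comp g f) (pm_comp g' f) :=
  {| ac0 := ac0 a ▷ pm0 f |}.
Next Obligation.
apply: pk_inj; pack; noeqc.
have H := f_equal (lwhisk (act Z)) (pfC_rwhisk_inv T (ac0 a) (pm0 f)); topack H; prw H.
have H1 := interchange (ac0 a) (pm1 f); topack H1; prw H1.
by have H2 := f_equal (fun b => b ▷ pf1 T (pm0 f)) (ac_nat a); topack H2; prw H2.
Qed.

Definition PsAlgData : TwoCatData := {|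
  ob := PsAlg T;
  hom := @PsMor C T;
  cell := @PsAlgCell C T;
  id1 := pm_id;
  comp1 := pm_comp;
  id2 := ac_id;
  vcomp := ac_vcomp;
  lwhisk := ac_lwhisk;
  rwhisk := ac_rwhisk |}.

Lemma pk_ac_eqcl (A B : PsAlgData) (s t u : hom A B) (e : t = u) (m : cell s t) :
  pk (ac0 (eqc e • m)) = pk (ac0 m).
Proof. by case: u / e; rewrite /= vcomp1c. Qed.
Lemma pk_ac_eqcr (A B : PsAlgData) (s t u : hom A B) (e : u = s) (m : cell s t) :
  pk (ac0 (m • eqc e)) = pk (ac0 m).
Proof. by move: m; case: s / e => m; rewrite /= vcompc1. Qed.

Lemma pk_ac_eqc (A B : PsAlgData) (s t : hom A B) (e : s = t) :
  pk (ac0 (eqc e)) = pk (id2 (pm0 s)).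
Proof. by case: t / e. Qed.

Program Definition PsTAlg : TwoCat := {| tcdata := PsAlgData |}.
Next Obligation. by apply: ac_ext; rewrite /= vcompA. Qed.
Next Obligation. by apply: ac_ext; rewrite /= vcomp1c. Qed.
Next Obligation. by apply: ac_ext; rewrite /= vcompc1. Qed.
Next Obligation. by apply: ac_ext; rewrite /= lwhisk_id. Qed.
Next Obligation. by apply: ac_ext; rewrite /= lwhisk_vcomp. Qed.
Next Obligation. by apply: ac_ext; rewrite /= rwhisk_id. Qed.
Next Obligation. by apply: ac_ext; rewrite /= rwhisk_vcomp. Qed.
Next Obligation. by apply: ac_ext; rewrite /= interchange. Qed.
Next Obligation.
apply: pm_ext => /=; first exact: comp1A.
pack; noeqc.
have H1 := interchange (pm1 h) (bwd (pfC T (pm0 g) (pm0 f))); topack H1; prw (esym H1).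
have H2 := f_equal (pl (act D)) (pfC_assoc_inv T (pm0 h) (pm0 g) (pm0 f)).
by pushl H2; prw H2.
Qed.
Next Obligation.
apply: pm_ext => /=; first exact: comp11f.
pack; noeqc.
by have H := f_equal (pl (act B)) (pfC_unitl_inv T (pm0 f)); pushl H; prw H; noeqc.
Qed.
Next Obligation.
apply: pm_ext => /=; first exact: comp1f1.
pack; noeqc.
have H1 := interchange (pm1 f) (bwd (pfU T (pa0 A))); topack H1; prw (esym H1).
by have H := f_equal (pl (act B)) (pfC_unitr_inv T (pm0 f)); pushl H; prw H; noeqc.
Qed.
Next Obligation.
by apply: ac_ext; apply: pk_inj; rewrite pk_ac_eqcl pk_ac_eqcr /=; pack.
Qed.
Next Obligation.
by apply: ac_ext; apply: pk_inj; rewrite pk_ac_eqcl pk_ac_eqcr /=; pack.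
Qed.
Next Obligation.
by apply: ac_ext; apply: pk_inj; rewrite pk_ac_eqcl pk_ac_eqcr /=; pack.
Qed.
Next Obligation.
by apply: ac_ext; apply: pk_inj; rewrite pk_ac_eqcl pk_ac_eqcr /=; pack.
Qed.
Next Obligation.
by apply: ac_ext; apply: pk_inj; rewrite pk_ac_eqcl pk_ac_eqcr /=; pack.
Qed.

(** The forgetful 2-functor; its structure cells are identities. *)
Program Definition forgetful : Pseudofunctor PsTAlg C :=
  {| pf0 := fun A : PsTAlg => pa0 A;
     pf1 := fun A B (f : @hom PsTAlg A B) => pm0 f;
     pf2 := fun A B f g (a : @cell PsTAlg A B f g) => ac0 a;
     pfC := fun X Y Z g f =>
       @Iso2 _ _ _ (pm0 g ∘ pm0 f) (pm0 g ∘ pm0 f) (id2 _) (id2 _) _ _;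
     pfU := fun A => @Iso2 _ _ _ (id1 (pa0 A)) (id1 (pa0 A)) (id2 _) (id2 _) _ _ |}.
Next Obligation. exact: vcomp1c. Qed.
Next Obligation. exact: vcomp1c. Qed.
Next Obligation. exact: vcomp1c. Qed.
Next Obligation. exact: vcomp1c. Qed.
Next Obligation. by []. Qed.
Next Obligation. by []. Qed.
Next Obligation. by rewrite vcomp1c vcompc1. Qed.
Next Obligation. by rewrite vcomp1c vcompc1. Qed.
Next Obligation.
rewrite lwhisk_id rwhisk_id !vcomp1c vcompc1.
by apply: pk_inj; rewrite pk_eqc; exact: (pk_ac_eqc (comp1A h g f)).
Qed.
Next Obligation.
rewrite rwhisk_id !vcompc1.
by apply: pk_inj; rewrite pk_eqc; exact: (pk_ac_eqc (comp11f f)).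
Qed.
Next Obligation.
rewrite lwhisk_id !vcompc1.
by apply: pk_inj; rewrite pk_eqc; exact: (pk_ac_eqc (comp1f1 f)).
Qed.
End PsAlg.

(** * Categories, comma categories, equivalences *)

Record Category := {
  cob :> Type;
  chom : cob -> cob -> Type;
  cid : forall x, chom x x;
  ccomp : forall x y z, chom y z -> chom x y -> chom x z;
  ccompA : forall (w x y z : cob) (h : chom y z) (g : chom x y) (f : chom w x),
      ccomp h (ccomp g f) = ccomp (ccomp h g) f;
  ccomp1f : forall (x y : cob) (f : chom x y), ccomp (cid y) f = f;
  ccompf1 : forall (x y : cob) (f : chom x y), ccomp f (cid x) = f }.

Arguments chom {_} _ _.
Arguments cid {_} _.
Arguments ccomp {_ _ _ _} _ _.

Record Functor (X Y : Category) := {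
  f0 :> X -> Y;
  f1 : forall x x' : X, chom x x' -> chom (f0 x) (f0 x');
  f1_id : forall x : X, f1 (cid x) = cid (f0 x);
  f1_comp : forall (x x' x'' : X) (g : chom x' x'') (f : chom x x'),
      f1 (ccomp g f) = ccomp (f1 g) (f1 f) }.

Arguments f1 {X Y} _ {x x'} _.

Program Definition fun_id (X : Category) : Functor X X :=
  {| f0 := fun x => x; f1 := fun x x' a => a |}.
Solve All Obligations with reflexivity.

Program Definition fun_comp (X Y Z : Category) (G : Functor Y Z) (F : Functor X Y) :
  Functor X Z := {| f0 := fun x => G (F x); f1 := fun x x' a => f1 G (f1 F a) |}.
Next Obligation. by rewrite !f1_id. Qed.
Next Obligation. by rewrite !f1_comp. Qed.

Definition is_full (X Y : Category) (F : Functor X Y) : Prop :=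
  forall (x x' : X) (b : chom (F x) (F x')), exists a : chom x x', f1 F a = b.

Record NatIso (X Y : Category) (F G : Functor X Y) := {
  ni : forall x : X, chom (F x) (G x);
  ni_inv : forall x : X, chom (G x) (F x);
  ni_nat : forall (x x' : X) (a : chom x x'),
      ccomp (ni x') (f1 F a) = ccomp (f1 G a) (ni x);
  ni_invK : forall x : X, ccomp (ni x) (ni_inv x) = cid (G x);
  ni_Kinv : forall x : X, ccomp (ni_inv x) (ni x) = cid (F x) }.

Definition is_equivalence (X Y : Category) (F : Functor X Y) : Prop :=
  exists G : Functor Y X,
    inhabited (NatIso (fun_comp G F) (fun_id X)) /\
    inhabited (NatIso (fun_comp F G) (fun_id Y)).

Section Comma.
Context {X Y : Category} (G : Functor X Y).

(** The comma category [Y / G]. *)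
Record CommaOb := { cm_y : Y; cm_x : X; cm_b : chom cm_y (G cm_x) }.
Record CommaHom (p q : CommaOb) := {
  cm_u : chom (cm_y p) (cm_y q);
  cm_v : chom (cm_x p) (cm_x q);
  cm_sq : ccomp (f1 G cm_v) (cm_b p) = ccomp (cm_b q) cm_u }.

Lemma commahom_ext (p q : CommaOb) (a b : CommaHom p q) :
  cm_u a = cm_u b -> cm_v a = cm_v b -> a = b.
Proof.
case: a => u v s; case: b => u' v' s' /= E E'.
by case: u' / E s'; case: v' / E' => s'; f_equal; apply: proof_irrelevance.
Qed.

Program Definition comma_id (p : CommaOb) : CommaHom p p :=
  {| cm_u := cid _; cm_v := cid _ |}.
Next Obligation. by rewrite f1_id ccomp1f ccompf1. Qed.

Program Definition comma_comp (p q r : CommaOb) (b : CommaHom q r) (a : CommaHom p q) :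
  CommaHom p r := {| cm_u := ccomp (cm_u b) (cm_u a); cm_v := ccomp (cm_v b) (cm_v a) |}.
Next Obligation. by rewrite f1_comp -ccompA cm_sq ccompA cm_sq ccompA. Qed.

Program Definition Comma : Category :=
  {| cob := CommaOb; chom := CommaHom; cid := comma_id; ccomp := comma_comp |}.
Next Obligation. by apply: commahom_ext; rewrite /= ccompA. Qed.
Next Obligation. by apply: commahom_ext; rewrite /= ccomp1f. Qed.
Next Obligation. by apply: commahom_ext; rewrite /= ccompf1. Qed.
End Comma.

(** * Local fullness and colax bilimits of arrows *)

Definition homcat (C : TwoCat) (X Y : C) : Category := {|
  cob := hom X Y;
  chom := @cell C X Y;
  cid := @id2 C X Y;
  ccomp := @vcomp C X Y;
  ccompA := fun f g h k c b a => vcompA c b a;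
  ccomp1f := @vcomp1c C X Y;
  ccompf1 := @vcompc1 C X Y |}.

Definition pf_local (A B : TwoCat) (U : Pseudofunctor A B) (x y : A) :
  Functor (homcat x y) (homcat (U x) (U y)) := {|
  f0 := @pf1 A B U x y : homcat x y -> homcat (U x) (U y);
  f1 := fun f g a => pf2 U a;
  f1_id := fun f => pf2_id U f;
  f1_comp := fun f g h b a => pf2_vcomp U b a |}.

Definition locally_full (A B : TwoCat) (U : Pseudofunctor A B) : Prop :=
  forall x y : A, is_full (pf_local U x y).

Section ColaxBilimit.
Context {C : TwoCat}.

(** The functor [C(X, f)]. *)
Definition postcomp (X : C) {A B : C} (f : hom A B) : Functor (homcat X A) (homcat X B) := {|
  f0 := fun k : homcat X A => f ∘ k : homcat X B;
  f1 := fun k k' a => f ◁ a;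
  f1_id := fun k => lwhisk_id f k;
  f1_comp := fun k k' k'' b a => lwhisk_vcomp f b a |}.

Context {A B : C} (f : hom A B) (P : C) (p : hom P A) (q : hom P B) (l : cell q (f ∘ p)).

(** The functor [k |-> (q k, l k, p k)] from [C(X, P)] to [C(X, B) / C(X, f)]. *)
Definition colax_ob (X : C) (k : hom X P) : Comma (postcomp X f) :=
  @Build_CommaOb _ _ (postcomp X f) (q ∘ k) (p ∘ k) (idc • (l ▷ k) : cell (q ∘ k) (f ∘ (p ∘ k))).

Program Definition colax_fun (X : C) : Functor (homcat X P) (Comma (postcomp X f)) :=
  {| f0 := @colax_ob X : homcat X P -> Comma (postcomp X f);
     f1 := fun k k' a => {| cm_u := q ◁ a; cm_v := p ◁ a |} |}.
Next Obligation.
apply: pk_inj.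
have H := interchange l a; topack H.
by pack; rewrite H.
Qed.
Next Obligation. by apply: commahom_ext; rewrite /= lwhisk_id. Qed.
Next Obligation. by apply: commahom_ext; rewrite /= lwhisk_vcomp. Qed.

Definition is_colax_bilimit : Prop := forall X : C, is_equivalence (colax_fun X).
End ColaxBilimit.

Definition has_colax_bilimits_of_arrows (C : TwoCat) : Prop :=
  forall (A B : C) (f : hom A B),
    exists (P : C) (p : hom P A) (q : hom P B) (l : cell q (f ∘ p)), is_colax_bilimit l.

Definition colax_bilimit_property (A B : TwoCat) (U : Pseudofunctor A B) : Prop :=
  forall (x y : A) (f : hom (U x) (U y)),
    exists (z : A) (p : hom z x) (q : hom z y) (l : cell (pf1 U q) (f ∘ pf1 U p)),
      is_colax_bilimit l.

(* Main.v *)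
(** If [T] is lax-idempotent, the action [a] of every pseudoalgebra is left adjoint to
    the unit [eta], with invertible counit [act_unit].  Hence a 2-cell into a composite
    [k ∘ a] is determined by its restriction along [eta]; this makes every 2-cell
    between pseudomorphisms an algebra 2-cell, and gives every 1-cell [f] between
    algebras a canonical lax morphism structure [b ∘ T f => f ∘ a].  That structure
    turns the colax bilimit [(P, p, q)] of [f] into a pseudoalgebra: the universal
    property yields the action [T P -> P] and its coherence isomorphisms, and the
    coherence equations hold because they hold after composing with [p] and [q].

    Conversely, let [Z] be the colax bilimit of [eta (T x) : T x -> T (T x)] between
    free algebras.  The 1-cell [k : T x -> Z] corresponding to the identity 2-cell of
    [eta (T x)] extends to the pseudomorphism [z ∘ T k] on [T (T x)], and whiskering
    the universal 2-cell with it gives [u : 1 => eta (T x) ∘ mu x].  Local fullness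
    makes [(lambda mu) (mu u)] an algebra 2-cell between pseudomorphisms out of a free
    algebra, so that it is determined by its restriction along the unit, which is the
    identity.  The composite in the other triangle identity is then idempotent and
    invertible. *)

From Stdlib Require Import ssreflect ssrfun ClassicalEpsilon.
Require Import Defs.
Set Implicit Arguments.
Unset Strict Implicit.
Unset Printing Implicit Defensive.

(** * Pseudofunctors and pasting *)

Lemma tail4 (C : TwoCat) (A B : C) (a b c d r : pcell A B) :
  pc a (pc b (pc c d)) = r ->
  forall X, pc a (pc b (pc c (pc d X))) = pc r X.
Proof. by move=> <- X; rewrite !pcA. Qed.
Lemma tail5 (C : TwoCat) (A B : C) (a b c d e r : pcell A B) :
  pc a (pc b (pc c (pc d e))) = r ->
  forall X, pc a (pc b (pc c (pc d (pc e X)))) = pc r X.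
Proof. by move=> <- X; rewrite !pcA. Qed.

Ltac prw H ::= first [rewrite (tail5 H) | rewrite (tail4 H) | rewrite (tail3 H)
  | rewrite (tail2 H) | rewrite H]; rewrite -?pcA.
(** One step of a pasting calculation, modulo strict associativity and units; [pback] uses the
    equation from right to left. *)
Ltac pstep E := let H := fresh "H" in have H := E; topack H; prw H; clear H; noeqc.
Ltac pback E := let H := fresh "H" in have H := E; topack H; prw (esym H); clear H; noeqc.

Program Definition iso_rwhisk (C : TwoCat) (X Y Z : C) (g g' : hom Y Z) (i : iso2 g g')
  (f : hom X Y) : iso2 (g ∘ f) (g' ∘ f) :=
  @Iso2 _ _ _ (g ∘ f) (g' ∘ f) (i ▷ f) (bwd i ▷ f) _ _.
Next Obligation. by rewrite -rwhisk_vcomp fwd_bwd rwhisk_id. Qed.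
Next Obligation. by rewrite -rwhisk_vcomp bwd_fwd rwhisk_id. Qed.

(** Many calculations below first compose both sides with invertible cells that complete the left
    sides of known equations; this cancels such a cell across a strictness identity. *)
Lemma fwd_inj_idc (C : TwoCat) (A B : C) (f g h k : hom A B) (i : iso2 f g)
  (e : StrictEq h f) (a b : cell k h) :
  fwd i • eqc e • a = fwd i • eqc e • b -> a = b.
Proof.
move: (e : h = f) a b => {}e; case: f / e i => i a b.
by rewrite !vcomp1c; apply: fwd_inj.
Qed.

Lemma fwd_injr_idc (C : TwoCat) (A B : C) (f g h k : hom A B) (i : iso2 f g)
  (e : StrictEq g h) (a b : cell h k) :
  a • eqc e • fwd i = b • eqc e • fwd i -> a = b.
Proof.
move: (e : g = h) a b => {}e; case: h / e => a b.
by rewrite !vcomp1c; apply: fwd_injr.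
Qed.

Section General.
Context {A B : TwoCat} (F : Pseudofunctor A B).

(** The companion of [pf2sq] for the triangle of a colax bilimit. *)
Definition pf2co (x y z : A) (q : hom x z) (f : hom y z) (p : hom x y) (l : cell q (f ∘ p)) :
  cell (pf1 F q) (pf1 F f ∘ pf1 F p) := bwd (pfC F f p) • pf2 F l.

Lemma pf2sqE (x y y' z : A) (g : hom y z) (f : hom x y) (g' : hom y' z)
  (f' : hom x y') (a : cell (g ∘ f) (g' ∘ f')) :
  pfC F g' f' • pf2sq F a = pf2 F a • pfC F g f.
Proof. by rewrite /pf2sq vcompA fwd_bwd vcomp1c. Qed.

Lemma pf2unE (x y : A) (g : hom y x) (f : hom x y) (a : cell (g ∘ f) (id1 x)) :
  pfU F x • pf2un F a = pf2 F a • pfC F g f.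
Proof. by rewrite /pf2un vcompA fwd_bwd vcomp1c. Qed.

Lemma pf2coE (x y z : A) (q : hom x z) (f : hom y z) (p : hom x y) (l : cell q (f ∘ p)) :
  pfC F f p • pf2co l = pf2 F l.
Proof. by rewrite /pf2co vcompA fwd_bwd vcomp1c. Qed.

#[local] Opaque pf2sq pf2un pf2co.

(** One comparison cell for threefold composites, opaque below: sliding it past conjugated cells
    turns a pasting of them into [F] of a pasting. *)
Program Definition pfC3 (w x y z : A) (h : hom y z) (g : hom x y) (f : hom w x) :
  iso2 (pf1 F h ∘ pf1 F g ∘ pf1 F f) (pf1 F (h ∘ g ∘ f)) :=
  @Iso2 _ _ _ (pf1 F h ∘ pf1 F g ∘ pf1 F f) (pf1 F (h ∘ g ∘ f))
    (pfC F (h ∘ g) f • (pfC F h g ▷ pf1 F f))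
    ((bwd (pfC F h g) ▷ pf1 F f) • bwd (pfC F (h ∘ g) f)) _ _.
Next Obligation.
rewrite vcompA -(vcompA (pfC F _ f)) -rwhisk_vcomp fwd_bwd rwhisk_id vcompc1.
exact: fwd_bwd.
Qed.
Next Obligation.
rewrite vcompA -(vcompA (bwd _ ▷ _)) bwd_fwd vcompc1 -rwhisk_vcomp bwd_fwd.
exact: rwhisk_id.
Qed.

Lemma pfC3_fwd (w x y z : A) (h : hom y z) (g : hom x y) (f : hom w x) :
  pfC3 h g f = pfC F (h ∘ g) f • (pfC F h g ▷ pf1 F f) :> cell _ _.
Proof. by []. Qed.

#[local] Opaque pfC3.

Lemma pfC3E (w x y z : A) (h : hom y z) (g : hom x y) (f : hom w x) :
  pfC3 h g f • idc
  = pf2 F (idc : cell (h ∘ (g ∘ f)) (h ∘ g ∘ f))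
    • (pfC F h (g ∘ f)) • (pf1 F h ◁ pfC F g f).
Proof.
rewrite !pfC3_fwd; apply: pk_inj; pack; noeqc.
by pstep (pfC_assoc F h g f).
Qed.

(** Left whiskerings slide past [pfC3] through the bracketing of [pfC3E], right whiskerings through
    the defining one; the next lemmas follow the same pattern. *)
Lemma pfC3_lwhisk (w x x' y z : A) (h : hom y z) (g : hom x y) (f : hom w x)
  (g' : hom x' y) (f' : hom w x') (s : cell (g ∘ f) (g' ∘ f')) :
  pfC3 h g' f' • idc • (pf1 F h ◁ pf2sq F s)
  = pf2 F (idc • (h ◁ s) • idc) • pfC3 h g f • idc.
Proof.
apply: pk_inj; pack; noeqc.
pstep (pfC3E h g' f').
pstep (f_equal (lwhisk (pf1 F h)) (pf2sqE s)).
pstep (pfC_lwhisk F h s).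
by pback (pfC3E h g f).
Qed.

Lemma pfC3_rwhisk (w x y y' z : A) (h : hom y z) (g : hom x y) (f : hom w x)
  (h' : hom y' z) (g' : hom x y') (s : cell (h ∘ g) (h' ∘ g')) :
  pfC3 h' g' f • (pf2sq F s ▷ pf1 F f) = pf2 F (s ▷ f) • pfC3 h g f.
Proof.
rewrite !pfC3_fwd; apply: pk_inj; pack; noeqc.
pstep (f_equal (fun c => c ▷ pf1 F f) (pf2sqE s)).
by pstep (pfC_rwhisk F s f).
Qed.

Lemma pfC3_un_l (x y z : A) (h : hom y z) (g : hom x y) (f : hom y x)
  (s : cell (g ∘ f) (id1 y)) :
  idc • (pf1 F h ◁ pf2un F s)
  = pf2 F (idc • (h ◁ s) • idc : cell (h ∘ g ∘ f) h) • pfC3 h g f • idc.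
Proof.
apply: pk_inj; pack; noeqc.
have H := pfC_unitr F h; topack H.
pstep (pfC3E h g f).
pback (pfC_lwhisk F h s).
pback (f_equal (lwhisk (pf1 F h)) (pf2unE s)).
by prw H; noeqc.
Qed.

Lemma pfC3_un_r (w x y : A) (h : hom y x) (g : hom x y) (f : hom w x)
  (s : cell (h ∘ g) (id1 x)) :
  idc • (pf2un F s ▷ pf1 F f) = pf2 F (idc • (s ▷ f) : cell (h ∘ g ∘ f) f) • pfC3 h g f.
Proof.
rewrite !pfC3_fwd; apply: pk_inj; pack; noeqc.
have H := pfC_unitl F f; topack H.
pback (pfC_rwhisk F s f).
pback (f_equal (fun c => c ▷ pf1 F f) (pf2unE s)).
by prw H; noeqc.
Qed.

Lemma pfC3_co_l (w x y z : A) (h : hom y z) (g : hom x y) (f : hom w x)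
  (q : hom w y) (s : cell q (g ∘ f)) :
  pfC3 h g f • idc • (pf1 F h ◁ pf2co s) = pf2 F (idc • (h ◁ s)) • pfC F h q.
Proof.
apply: pk_inj; pack; noeqc.
pstep (pfC3E h g f).
pstep (f_equal (lwhisk (pf1 F h)) (pf2coE s)).
by pstep (pfC_lwhisk F h s).
Qed.

Lemma pfC3_co_r (w x y z : A) (h : hom y z) (g : hom x y) (f : hom w x)
  (q : hom x z) (s : cell q (h ∘ g)) :
  pfC3 h g f • (pf2co s ▷ pf1 F f) = pf2 F (s ▷ f) • pfC F q f.
Proof.
rewrite !pfC3_fwd; apply: pk_inj; pack; noeqc.
pstep (f_equal (fun c => c ▷ pf1 F f) (pf2coE s)).
by pstep (pfC_rwhisk F s f).
Qed.

(** [F] preserves the commutativity of a cube of squares. *)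
Lemma pf2sq_cube (x0 y1 y2 y3 z1 z2 z3 x3 : A)
  (a0 : hom x0 y1) (a1 : hom y1 z1) (a2 : hom z1 x3)
  (b0 : hom x0 y2) (b1 : hom y2 z1) (b2 : hom y2 z2) (c2 : hom z2 x3)
  (d0 : hom x0 y3) (d1 : hom y3 z2) (e1 : hom y1 z3) (e2 : hom z3 x3) (e3 : hom y3 z3)
  (s1 : cell (a1 ∘ a0) (b1 ∘ b0)) (s2 : cell (a2 ∘ b1) (c2 ∘ b2))
  (s3 : cell (b2 ∘ b0) (d1 ∘ d0))
  (t1 : cell (a2 ∘ a1) (e2 ∘ e1)) (t2 : cell (e1 ∘ a0) (e3 ∘ d0))
  (t3 : cell (e2 ∘ e3) (c2 ∘ d1)) :
  (c2 ◁ s3) • idc • (s2 ▷ b0) • idc • (a2 ◁ s1)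
  = idc • (t3 ▷ d0) • idc • (e2 ◁ t2) • idc • (t1 ▷ a0) • idc ->
  (pf1 F c2 ◁ pf2sq F s3) • idc • (pf2sq F s2 ▷ pf1 F b0) • idc • (pf1 F a2 ◁ pf2sq F s1)
  = idc • (pf2sq F t3 ▷ pf1 F d0) • idc • (pf1 F e2 ◁ pf2sq F t2) • idc
    • (pf2sq F t1 ▷ pf1 F a0) • idc.
Proof.
move=> E.
apply: (fwd_inj_idc (i := pfC3 c2 d1 d0)).
apply: pk_inj; pack; noeqc.
pstep (pfC3_lwhisk c2 s3).
pstep (pfC3_rwhisk b0 s2).
pstep (pfC3_lwhisk a2 s1).
pstep (f_equal (pf2 F) E).
pstep (pfC3_rwhisk d0 t3).
pstep (pfC3_lwhisk e2 t2).
by pstep (pfC3_rwhisk a0 t1).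
Qed.

Section Unit.
Context {x0 y1 y2 z1 x3 : A} {p : hom x0 x3} {c : hom y2 x0} {h : hom x0 y2}
  {a : hom z1 x3} {p' : hom y2 z1} {h' : hom x3 z1}
  (e : cell (c ∘ h) (id1 x0)) (s : cell (a ∘ p') (p ∘ c)) (n : cell (h' ∘ p) (p' ∘ h))
  (e' : cell (a ∘ h') (id1 x3)).

Lemma pf2sq_unitE :
  idc • (pf1 F p ◁ pf2un F e) • idc • (pf2sq F s ▷ pf1 F h) • idc • (pf1 F a ◁ pf2sq F n)
  = pf2 F (idc • (p ◁ e) • idc • (s ▷ h) • idc • (a ◁ n) • idc : cell (a ∘ h' ∘ p) p)
    • pfC3 a h' p • idc.
Proof.
apply: pk_inj; pack; noeqc.
pstep (pfC3_un_l p e).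
pstep (pfC3_rwhisk h s).
by pstep (pfC3_lwhisk a n).
Qed.

Lemma pf2sq_unit :
  idc • (p ◁ e) • idc • (s ▷ h) • idc • (a ◁ n) • idc
  = idc • (e' ▷ p) :> cell (a ∘ h' ∘ p) p ->
  idc • (pf1 F p ◁ pf2un F e) • idc • (pf2sq F s ▷ pf1 F h) • idc • (pf1 F a ◁ pf2sq F n)
  = idc • (pf2un F e' ▷ pf1 F p) • idc :> cell (pf1 F a ∘ (pf1 F h' ∘ pf1 F p)) (pf1 F p).
Proof.
move=> E; rewrite pf2sq_unitE E.
apply: pk_inj; pack; noeqc.
by pback (pfC3_un_r p e').
Qed.

(** The converse of [pf2sq_unit] under [g]; when [g] is an action, [act_faithful] then strips both
    [g] and [F]. *)
Lemma pf2sq_unit_inv (w : B) (g : hom (F x3) w) :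
  g ◁ (idc • (pf1 F p ◁ pf2un F e) • idc • (pf2sq F s ▷ pf1 F h) • idc
       • (pf1 F a ◁ pf2sq F n))
  = g ◁ (idc • (pf2un F e' ▷ pf1 F p) • idc
         : cell (pf1 F a ∘ (pf1 F h' ∘ pf1 F p)) (pf1 F p)) ->
  g ◁ pf2 F (idc • (p ◁ e) • idc • (s ▷ h) • idc • (a ◁ n) • idc)
  = g ◁ pf2 F (idc • (e' ▷ p) : cell (a ∘ h' ∘ p) p).
Proof.
rewrite pf2sq_unitE => E.
apply: (fwd_injr (i := iso_lwhisk g (pfC3 a h' p))); rewrite /= -!lwhisk_vcomp -pfC3_un_r.
apply: pk_inj; have {}E := f_equal pk E.
by rewrite vcompA lwhisk_vcomp lwhisk_eqc pk_eqcr in E; rewrite E; pack.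
Qed.
End Unit.

(** The analogue of [pf2sq_cube] for a prism; it will give the image under [T] of the compatibility
    of a colax cell with the lifted actions. *)
Lemma pf2co_prism (x0 y1 y2 z1 x3 w : A)
  (c : hom x0 y1) (q : hom y1 x3) (p : hom y1 z1) (f : hom z1 x3)
  (q' : hom x0 w) (b : hom w x3) (p' : hom x0 y2) (a : hom y2 z1) (f' : hom y2 w)
  (l : cell q (f ∘ p)) (l' : cell q' (f' ∘ p')) (sq : cell (b ∘ q') (q ∘ c))
  (sp : cell (a ∘ p') (p ∘ c)) (sf : cell (b ∘ f') (f ∘ a)) :
  (l ▷ c) • sq = idc • (f ◁ sp) • idc • (sf ▷ p') • idc • (b ◁ l') ->
  (pf2co l ▷ pf1 F c) • pf2sq F sq
  = idc • (pf1 F f ◁ pf2sq F sp) • idc • (pf2sq F sf ▷ pf1 F p') • idc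
    • (pf1 F b ◁ pf2co l').
Proof.
move=> E; apply: (fwd_inj_idc (i := pfC3 f p c)); apply: pk_inj; pack; noeqc.
pstep (pfC3_co_r c l).
pstep (pf2sqE sq).
pstep (f_equal (pf2 F) E).
pstep (pfC3_lwhisk f sp).
pstep (pfC3_rwhisk p' sf).
by pstep (pfC3_co_l b l').
Qed.
End General.

(** * Conjugated actions: vertical composition, inverses, composite pseudofunctors *)

Section Functoriality.
Context {A B : TwoCat} (F : Pseudofunctor A B).

Lemma pf2sq_vcomp (x y y' y'' z : A) (g : hom y z) (f : hom x y) (g' : hom y' z)
  (f' : hom x y') (g'' : hom y'' z) (f'' : hom x y'') (b : cell (g' ∘ f') (g'' ∘ f''))
  (a : cell (g ∘ f) (g' ∘ f')) :
  pf2sq F (b • a) = pf2sq F b • pf2sq F a.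
Proof.
apply: (fwd_inj (i := pfC F g'' f'')).
by rewrite vcompA !pf2sqE -vcompA pf2sqE pf2_vcomp vcompA.
Qed.

Lemma pf2sq_id (x y z : A) (g : hom y z) (f : hom x y) :
  pf2sq F (id2 (g ∘ f)) = id2 (pf1 F g ∘ pf1 F f).
Proof.
by apply: (fwd_inj (i := pfC F g f)); rewrite pf2sqE pf2_id vcomp1c vcompc1.
Qed.

Program Definition pf2sqI (x y y' z : A) (g : hom y z) (f : hom x y) (g' : hom y' z)
  (f' : hom x y') (i : iso2 (g ∘ f) (g' ∘ f')) :
  iso2 (pf1 F g ∘ pf1 F f) (pf1 F g' ∘ pf1 F f') :=
  @Iso2 _ _ _ (pf1 F g ∘ pf1 F f) (pf1 F g' ∘ pf1 F f') (pf2sq F i) (pf2sq F (bwd i)) _ _.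
Next Obligation. by rewrite -pf2sq_vcomp fwd_bwd pf2sq_id. Qed.
Next Obligation. by rewrite -pf2sq_vcomp bwd_fwd pf2sq_id. Qed.

Program Definition pf2unI (x y : A) (g : hom y x) (f : hom x y)
  (i : iso2 (g ∘ f) (id1 x)) : iso2 (pf1 F g ∘ pf1 F f) (id1 (F x)) :=
  @Iso2 _ _ _ (pf1 F g ∘ pf1 F f) (id1 (F x)) (pf2un F i)
    (bwd (pfC F g f) • pf2 F (bwd i) • pfU F x) _ _.
Next Obligation.
apply: (fwd_inj (i := pfU F x)).
rewrite vcompA pf2unE -!vcompA (vcompA (pfC F g f)) fwd_bwd vcomp1c vcompA -pf2_vcomp.
by rewrite fwd_bwd pf2_id vcomp1c vcompc1.
Qed.
Next Obligation.
rewrite -!vcompA pf2unE (vcompA (pf2 F _)) -pf2_vcomp bwd_fwd pf2_id vcomp1c.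
exact: bwd_fwd.
Qed.

(** As [mu] starts at [pf_comp T T] and [eta] at [pf_id C], these identities express their
    pseudonaturality through [T] alone. *)
Lemma pf2sq_compE (D : TwoCat) (G : Pseudofunctor B D) (x y y' z : A) (g : hom y z)
  (f : hom x y) (g' : hom y' z) (f' : hom x y') (a : cell (g ∘ f) (g' ∘ f')) :
  pf2sq (pf_comp G F) a = pf2sq G (pf2sq F a).
Proof.
apply: (fwd_inj (i := pfC (pf_comp G F) g' f')); rewrite pf2sqE /=.
by rewrite -!vcompA pf2sqE !vcompA -!pf2_vcomp pf2sqE.
Qed.

Lemma pf2co_compE (D : TwoCat) (G : Pseudofunctor B D) (x y z : A) (q : hom x z)
  (f : hom y z) (p : hom x y) (l : cell q (f ∘ p)) :
  pf2co (pf_comp G F) l = pf2co G (pf2co F l).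
Proof.
apply: (fwd_inj (i := pfC (pf_comp G F) f p)); rewrite pf2coE /=.
by rewrite -!vcompA pf2coE -!pf2_vcomp pf2coE.
Qed.

Lemma pf2sq_idE (x y y' z : A) (g : hom y z)
  (f : hom x y) (g' : hom y' z) (f' : hom x y') (a : cell (g ∘ f) (g' ∘ f')) :
  pf2sq (pf_id A) a = a.
Proof.
by apply: (fwd_inj (i := pfC (pf_id A) g' f')); rewrite pf2sqE /= vcomp1c vcompc1.
Qed.

Lemma pf2un_idE (x y : A) (g : hom y x) (f : hom x y) (a : cell (g ∘ f) (id1 x)) :
  pf2un (pf_id A) a = a.
Proof.
by apply: (fwd_inj (i := pfU (pf_id A) x)); rewrite pf2unE /= vcomp1c vcompc1.
Qed.

Lemma pf2co_idE (x y z : A) (q : hom x z) (f : hom y z) (p : hom x y)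
  (l : cell q (f ∘ p)) : pf2co (pf_id A) l = l.
Proof.
by apply: (fwd_inj (i := pfC (pf_id A) f p)); rewrite pf2coE /= vcomp1c.
Qed.
End Functoriality.

(** * Pseudonaturality at conjugated 2-cells *)

Section Naturality.
Context {A B : TwoCat} {F G : Pseudofunctor A B} (t : Pseudonat F G).

(** Composing with the comparison cell of [G] replaces the conjugated action by [pf2], to which
    [pn1_nat] applies between two uses of [pn1_comp]. *)
Lemma pn1_sq (x y y' z : A) (g : hom y z) (f : hom x y) (g' : hom y' z)
  (f' : hom x y') (s : cell (g ∘ f) (g' ∘ f')) :
  (pf2sq G s ▷ t x) • idc • (pf1 G g ◁ pn1 t f) • idc • (pn1 t g ▷ pf1 F f) • idc
  = idc • (pf1 G g' ◁ pn1 t f') • idc • (pn1 t g' ▷ pf1 F f') • idc • (t z ◁ pf2sq F s).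
Proof.
apply: (fwd_inj (i := iso_rwhisk (pfC G g' f') (t x))).
apply: pk_inj; pack; noeqc.
pstep (f_equal (fun c => c ▷ t x) (pf2sqE G s)).
pback (pn1_comp t g f).
pback (pn1_nat t s).
pback (f_equal (lwhisk (t z)) (pf2sqE F s)).
by pstep (pn1_comp t g' f').
Qed.

Lemma pn1_un (x y : A) (g : hom y x) (f : hom x y) (s : cell (g ∘ f) (id1 x)) :
  (pf2un G s ▷ t x) • idc • (pf1 G g ◁ pn1 t f) • idc • (pn1 t g ▷ pf1 F f) • idc
  = idc • (t x ◁ pf2un F s).
Proof.
apply: (fwd_inj (i := iso_rwhisk (pfU G x) (t x))).
apply: pk_inj; pack; noeqc.
pstep (f_equal (fun c => c ▷ t x) (pf2unE G s)).
pback (pn1_comp t g f).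
pback (pn1_nat t s).
pback (f_equal (lwhisk (t x)) (pf2unE F s)).
by pstep (pn1_unit t x).
Qed.

Lemma pn1_co (x y z : A) (q : hom x z) (f : hom y z) (p : hom x y) (l : cell q (f ∘ p)) :
  (pf2co G l ▷ t x) • pn1 t q
  = idc • (pf1 G f ◁ pn1 t p) • idc • (pn1 t f ▷ pf1 F p) • idc • (t z ◁ pf2co F l).
Proof.
apply: (fwd_inj (i := iso_rwhisk (pfC G f p) (t x))).
apply: pk_inj; pack; noeqc.
pstep (f_equal (fun c => c ▷ t x) (pf2coE G l)).
pback (pn1_nat t l).
pback (f_equal (lwhisk (t z)) (pf2coE F l)).
by pstep (pn1_comp t f p).
Qed.
End Naturality.

(** * Unit laws *)

(** Interchange of [e] with itself equates the two sides after composition with [e], which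
    cancels. *)
Lemma iso_id_comm (C : TwoCat) (x : C) (h : hom x x) (e : iso2 h (id1 x)) :
  idc • (e ▷ h) • idc = idc • (h ◁ e) • idc :> cell (h ∘ h) h.
Proof.
apply: (fwd_inj (i := e)); apply: pk_inj; pack; noeqc.
by pstep (interchange e e).
Qed.

Section Pseudomonad.
Context {C : TwoCat} (T : Pseudomonad C).

(** Components with ends spelled out in [C], made opaque below so that [pack] treats them as
    atoms. *)
Definition alpha_at x : cell (mu T x ∘ pf1 T (mu T x)) (mu T x ∘ mu T (T x)) :=
  mod0 (fwd (alpha T)) x.
Definition lambda_at x : cell (mu T x ∘ eta T (T x)) (id1 (T x)) := mod0 (fwd (lambda T)) x.
Definition lambdaV_at x : cell (id1 (T x)) (mu T x ∘ eta T (T x)) := mod0 (bwd (lambda T)) x.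
Definition rho_at x : cell (id1 (T x)) (mu T x ∘ pf1 T (eta T x)) := mod0 (fwd (rho T)) x.
Definition rhoV_at x : cell (mu T x ∘ pf1 T (eta T x)) (id1 (T x)) := mod0 (bwd (rho T)) x.

Lemma lambda_atK x : lambda_at x • lambdaV_at x = id2 _.
Proof. exact: (f_equal (fun m => mod0 m x) (fwd_bwd (lambda T))). Qed.
Lemma lambdaV_atK x : lambdaV_at x • lambda_at x = id2 _.
Proof. exact: (f_equal (fun m => mod0 m x) (bwd_fwd (lambda T))). Qed.
Lemma rho_atK x : rho_at x • rhoV_at x = id2 _.
Proof. exact: (f_equal (fun m => mod0 m x) (fwd_bwd (rho T))). Qed.
Lemma rhoV_atK x : rhoV_at x • rho_at x = id2 _.
Proof. exact: (f_equal (fun m => mod0 m x) (bwd_fwd (rho T))). Qed.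

Lemma rho_at_nat x y (f : hom x y) :
  (pf1 T f ◁ rho_at x) • idc
  = idc • (pn1 (mu T) f ▷ pf1 T (eta T x)) • idc • (mu T y ◁ pf2sq T (pn1 (eta T) f)) • idc
    • (rho_at y ▷ pf1 T f) • idc
  :> cell (pf1 T f) (pf1 T f ∘ (mu T x ∘ pf1 T (eta T x))).
Proof.
have H := mod_nat (fwd (rho T)) f; rewrite /pf2sq /rho_at; topack H.
by apply: pk_inj; pack; prw H; noeqc.
Qed.

Lemma lambda_at_nat x y (f : hom x y) :
  idc • (pf1 T f ◁ lambda_at x) • idc • (pn1 (mu T) f ▷ eta T (T x)) • idc
    • (mu T y ◁ pn1 (eta T) (pf1 T f)) • idc
  = idc • (lambda_at y ▷ pf1 T f) :> cell (mu T y ∘ eta T (T y) ∘ pf1 T f) (pf1 T f).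
Proof.
have H := mod_nat (fwd (lambda T)) f; rewrite /lambda_at; topack H.
by apply: pk_inj; pack; move: H; noeqc.
Qed.

Lemma alpha_at_nat x y (f : hom x y) :
  (pf1 T f ◁ alpha_at x) • idc • (pn1 (mu T) f ▷ pf1 T (mu T x)) • idc
    • (mu T y ◁ pf2sq T (pn1 (mu T) f)) • idc
  = idc • (pn1 (mu T) f ▷ mu T (T x)) • idc • (mu T y ◁ pn1 (mu T) (pf1 T f)) • idc
    • (alpha_at y ▷ pf1 T (pf1 T (pf1 T f))).
Proof.
have H := mod_nat (fwd (alpha T)) f; rewrite /pf2sq /alpha_at; topack H.
by apply: pk_inj; pack; move: H; noeqc.
Qed.

Lemma pm_unit_at x :
  (alpha_at x ▷ pf1 T (eta T (T x))) • idc
  = idc • (mu T x ◁ rho_at (T x)) • (mu T x ◁ pf2un T (lambda_at x)).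
Proof. exact: pm_unit. Qed.

#[local] Opaque pf2sq pf2un pf2co alpha_at lambda_at rho_at lambdaV_at rhoV_at.

Lemma eta_un x y (g : hom y x) (f : hom x y) (s : cell (g ∘ f) (id1 x)) :
  (pf2un T s ▷ eta T x) • idc • (pf1 T g ◁ pn1 (eta T) f) • idc
    • (pn1 (eta T) g ▷ f) • idc
  = idc • (eta T x ◁ s).
Proof. by have := pn1_un (eta T) s; rewrite pf2un_idE. Qed.

Lemma eta_sq x y y' z (g : hom y z) (f : hom x y) (g' : hom y' z)
  (f' : hom x y') (s : cell (g ∘ f) (g' ∘ f')) :
  (pf2sq T s ▷ eta T x) • idc • (pf1 T g ◁ pn1 (eta T) f) • idc
    • (pn1 (eta T) g ▷ f) • idc
  = idc • (pf1 T g' ◁ pn1 (eta T) f') • idc • (pn1 (eta T) g' ▷ f') • idc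
    • (eta T z ◁ s).
Proof. by have := pn1_sq (eta T) s; rewrite pf2sq_idE. Qed.

Lemma eta_co x y z (q : hom x z) (f : hom y z) (p : hom x y) (l : cell q (f ∘ p)) :
  (pf2co T l ▷ eta T x) • pn1 (eta T) q
  = idc • (pf1 T f ◁ pn1 (eta T) p) • idc • (pn1 (eta T) f ▷ p) • idc • (eta T z ◁ l).
Proof. by have := pn1_co (eta T) l; rewrite pf2co_idE. Qed.

Lemma mu_sq x y y' z (g : hom y z) (f : hom x y) (g' : hom y' z)
  (f' : hom x y') (s : cell (g ∘ f) (g' ∘ f')) :
  (pf2sq T s ▷ mu T x) • idc • (pf1 T g ◁ pn1 (mu T) f) • idc
    • (pn1 (mu T) g ▷ pf1 T (pf1 T f)) • idc
  = idc • (pf1 T g' ◁ pn1 (mu T) f') • idc • (pn1 (mu T) g' ▷ pf1 T (pf1 T f')) • idc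
    • (mu T z ◁ pf2sq T (pf2sq T s)).
Proof. by have := pn1_sq (mu T) s; rewrite pf2sq_compE. Qed.

Lemma mu_co x y z (q : hom x z) (f : hom y z) (p : hom x y) (l : cell q (f ∘ p)) :
  (pf2co T l ▷ mu T x) • pn1 (mu T) q
  = idc • (pf1 T f ◁ pn1 (mu T) p) • idc • (pn1 (mu T) f ▷ pf1 T (pf1 T p)) • idc
    • (mu T z ◁ pf2co T (pf2co T l)).
Proof. by have := pn1_co (mu T) l; rewrite pf2co_compE. Qed.

(** The action on 2-cells followed by [act] is faithful, as [act ∘ T s ∘ eta] is a
    conjugate of [s]. *)
Lemma act_faithful (A : PsAlg T) (x : C) (f g : hom x (pa0 A)) (s t : cell f g) :
  act A ◁ pf2 T s = act A ◁ pf2 T t -> s = t.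
Proof.
move=> E.
have E' : (act A ∘ eta T (pa0 A)) ◁ s = (act A ∘ eta T (pa0 A)) ◁ t.
  apply: (fwd_inj_idc (i := iso_lwhisk (act A) (pn1 (eta T) g))).
  apply: pk_inj; pack; noeqc.
  pstep (f_equal (lwhisk (act A)) (pn1_nat (eta T) s)).
  pstep (f_equal (fun c => c ▷ eta T x) E).
  by pback (f_equal (lwhisk (act A)) (pn1_nat (eta T) t)).
apply: pk_inj.
have := f_equal (fun c => (act_unit A ▷ g) • c • (bwd (act_unit A) ▷ f)) E'.
move=> {}E; topack E; move: E.
pstep (interchange (act_unit A) s). pstep (interchange (act_unit A) t).
by pstep (f_equal (fun c => c ▷ f) (fwd_bwd (act_unit A))).
Qed.

(** The unit equation which [PsAlg] leaves out, by the argument of Kelly for monoidal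
    categories: whiskering [act_assoc] with [T (eta T)] and removing the units gives the
    image of the equation under [act ∘ T], which is faithful on 2-cells. *)
Lemma act_unit_l (A : PsAlg T) :
  idc • (act A ◁ lambda_at (pa0 A)) • idc • (act_mult A ▷ eta T (T (pa0 A))) • idc
    • (act A ◁ pn1 (eta T) (act A)) • idc
  = idc • (act_unit A ▷ act A) :> cell (act A ∘ eta T (pa0 A) ∘ act A) (act A).
Proof.
apply: act_faithful.
have E : act A ◁ (idc • (pf1 T (act A) ◁ pf2un T (lambda_at (pa0 A))) • idc
      • (pf2sq T (act_mult A) ▷ pf1 T (eta T (T (pa0 A)))) • idc
      • (pf1 T (act A) ◁ pf2sq T (pn1 (eta T) (act A))))
    = act A ◁ (idc • (pf2un T (act_unit A) ▷ pf1 T (act A)) • idc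
        : cell (pf1 T (act A) ∘ (pf1 T (eta T (pa0 A)) ∘ pf1 T (act A))) (pf1 T (act A))).
  apply: (fwd_inj (i := act_mult A)).
  apply: (fwd_inj_idc (i := iso_lwhisk (act A) (iso_lwhisk (mu T (pa0 A)) 
    (@Iso2 _ _ _ _ _ (rho_at (T (pa0 A))) (rhoV_at (T (pa0 A))) (rho_atK _) (rhoV_atK _))))).
  apply: pk_inj; pack; noeqc.
  pstep (interchange (act_mult A) (pf2un T (lambda_at (pa0 A)))).
  pback (f_equal (lwhisk (act A)) (pm_unit_at (pa0 A))).
  pstep (f_equal (fun c => c ▷ pf1 T (eta T (T (pa0 A)))) (act_assoc A)).
  pstep (interchange (act_mult A) (pf2sq T (pn1 (eta T) (act A)))).
  pback (interchange (act_mult A) (rho_at (T (pa0 A)))).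
  pstep (f_equal (lwhisk (act A)) (rho_at_nat (act A))).
  by pback (f_equal (fun c => c ▷ pf1 T (act A)) (act_unital A)).
exact: pf2sq_unit_inv E.
Qed.

(** In a pseudomonad [theta] is the identity, but that needs the naturality of [theta];
    [act_theta] below is easier and suffices. *)
Definition theta (x : C) : cell (eta T x) (eta T x) :=
  idc • (lambda_at x ▷ eta T x) • idc • (mu T x ◁ bwd (pn1 (eta T) (eta T x))) • idc
    • (rho_at x ▷ eta T x) • idc.

Definition thetaV (x : C) : cell (eta T x) (eta T x) :=
  idc • (rhoV_at x ▷ eta T x) • idc • (mu T x ◁ pn1 (eta T) (eta T x)) • idc
    • (lambdaV_at x ▷ eta T x) • idc.

Lemma thetaK x : theta x • thetaV x = id2 _.
Proof.
rewrite /theta /thetaV; apply: pk_inj; pack; noeqc.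
pstep (f_equal (fun c => c ▷ eta T x) (rho_atK x)).
pstep (f_equal (lwhisk (mu T x)) (bwd_fwd (pn1 (eta T) (eta T x)))).
by pstep (f_equal (fun c => c ▷ eta T x) (lambda_atK x)).
Qed.

Lemma thetaVK x : thetaV x • theta x = id2 _.
Proof.
rewrite /theta /thetaV; apply: pk_inj; pack; noeqc.
pstep (f_equal (fun c => c ▷ eta T x) (lambdaV_atK x)).
pstep (f_equal (lwhisk (mu T x)) (fwd_bwd (pn1 (eta T) (eta T x)))).
by pstep (f_equal (fun c => c ▷ eta T x) (rhoV_atK x)).
Qed.

(** The unit laws rewrite [act A ◁ theta] after [h ◁ act_unit A] as [act_unit A ▷ h]; by
    [iso_id_comm] this is [h ◁ act_unit A] again, an invertible cell that cancels. *)
Lemma act_theta (A : PsAlg T) : act A ◁ theta (pa0 A) = id2 _.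
Proof.
set h := act A ∘ eta T (pa0 A).
have E : (act A ◁ theta (pa0 A)) • idc • (h ◁ act_unit A)
   = idc • (act_unit A ▷ h) • idc :> cell (h ∘ h) h.
  apply: pk_inj; rewrite /theta /h; pack; noeqc.
  pback (f_equal (lwhisk (act A)) (eta_un (act_unit A))).
  pback (f_equal (fun c => c ▷ eta T (pa0 A)) (act_unital A)).
  pstep (interchange (act_mult A) (pn1 (eta T) (eta T (pa0 A)))).
  pstep (f_equal (lwhisk (act A ∘ mu T (pa0 A))) (bwd_fwd (pn1 (eta T) (eta T (pa0 A))))).
  by pstep (f_equal (fun c => c ▷ eta T (pa0 A)) (act_unit_l A)).
have F := iso_id_comm (act_unit A).
apply: (fwd_injr_idc (i := iso_lwhisk h (act_unit A))).
by rewrite /h in E *; topack E; topack F; apply: pk_inj; pack; rewrite E F; noeqc.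
Qed.
End Pseudomonad.

(** * Using colax bilimits *)

Section Equivalences.
Context {X Y : Category} {F : Functor X Y}.

Lemma equivalence_faithful : is_equivalence F ->
  forall (x x' : X) (a b : chom x x'), f1 F a = f1 F b -> a = b.
Proof.
case=> G [[m] _] x x' a b E.
have H := ni_nat m a; rewrite /= E -[f1 G _]/(f1 (fun_comp G F) b) (ni_nat m b) /= in H.
by rewrite -(ccompf1 a) -(ccompf1 b) -(ni_invK m) /= !ccompA H.
Qed.

Lemma equivalence_full : is_equivalence F -> is_full F.
Proof.
case=> G [[m] [n]] x x' b.
have FG : forall y y' (a c : chom y y'), f1 G a = f1 G c -> a = c.
  move=> y y' a c E.
  have H := ni_nat n a; rewrite /= E -[f1 F _]/(f1 (fun_comp F G) c) (ni_nat n c) /= in H.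
  by rewrite -(ccompf1 a) -(ccompf1 c) -(ni_invK n) /= !ccompA H.
(* The preimage is [G b] conjugated by [m]; naturality of [m] gives it the same image as [b] under
   the faithful [G]. *)
exists (ccomp (ni m x') (ccomp (f1 G b) (ni_inv m x) : chom x (fun_comp G F x'))).
apply: FG; set a := ccomp _ _.
have H : ccomp (ni m x') (f1 G (f1 F a)) = ccomp a (ni m x) := ni_nat m a.
have K y : ccomp (ni_inv m y) (ni m y) = cid (G (F y)) := ni_Kinv m y.
rewrite -[LHS]ccomp1f -K -ccompA H /a -!ccompA K ccompf1 ccompA K.
by rewrite ccomp1f.
Qed.

Lemma equivalence_esurj : is_equivalence F -> forall y : Y,
  exists (x : X) (i : chom (F x) y) (j : chom y (F x)),
    ccomp i j = cid y /\ ccomp j i = cid (F x).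
Proof.
case=> G [_ [n]] y; exists (G y), (ni n y), (ni_inv n y).
by split; [exact: (ni_invK n y) | exact: (ni_Kinv n y)].
Qed.
End Equivalences.

Section ColaxBilimits.
Context {C : TwoCat} {A B P : C} {f : hom A B} {p : hom P A} {q : hom P B}
  {l : cell q (f ∘ p)} (L : is_colax_bilimit l).

Lemma colax_faithful (X : C) (k k' : hom X P) (w w' : cell k k') :
  q ◁ w = q ◁ w' -> p ◁ w = p ◁ w' -> w = w'.
Proof.
by move=> Eq Ep; apply: (equivalence_faithful (L X)); apply: commahom_ext.
Qed.

(** Fullness lifts the pair [u], [v] and the pair of inverses; faithfulness makes the two lifts
    mutually inverse. *)
Lemma colax_full (X : C) (k k' : hom X P) (u : iso2 (q ∘ k) (q ∘ k'))
  (v : iso2 (p ∘ k) (p ∘ k')) e e' :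
  (f ◁ v) • eqc e • (l ▷ k) = eqc e' • (l ▷ k') • u ->
  exists w : iso2 k k', q ◁ w = u /\ p ◁ w = v.
Proof.
move=> E.
have E1 : ccomp (f1 (postcomp X f) (fwd v : @chom (homcat X A) (p ∘ k) (p ∘ k')))
     (cm_b (colax_ob l k))
  = ccomp (cm_b (colax_ob l k')) (fwd u : @chom (homcat X B) (q ∘ k) (q ∘ k')).
  apply: pk_inj; topack E; rewrite /=; pack; exact: E.
have E2 : ccomp (f1 (postcomp X f) (bwd v : @chom (homcat X A) (p ∘ k') (p ∘ k)))
     (cm_b (colax_ob l k'))
  = ccomp (cm_b (colax_ob l k)) (bwd u : @chom (homcat X B) (q ∘ k') (q ∘ k)).
  apply: (fwd_inj (i := iso_lwhisk f v)); apply: (fwd_injr (i := u)).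
  apply: pk_inj; topack E; rewrite /=; pack; noeqc.
  pstep (bwd_fwd u); pstep (f_equal (lwhisk f) (fwd_bwd v)).
  by symmetry.
have [w Ew] := equivalence_full (L X) (x := k) (x' := k')
   (@Build_CommaHom _ _ _ (colax_ob l k) (colax_ob l k') (fwd u) (fwd v) E1).
have [w' Ew'] := equivalence_full (L X) (x := k') (x' := k)
   (@Build_CommaHom _ _ _ (colax_ob l k') (colax_ob l k) (bwd u) (bwd v) E2).
have qw := f_equal (@cm_u _ _ _ _ _) Ew; have pw := f_equal (@cm_v _ _ _ _ _) Ew.
have qw' := f_equal (@cm_u _ _ _ _ _) Ew'; have pw' := f_equal (@cm_v _ _ _ _ _) Ew'.
rewrite /= in qw pw qw' pw'.
have K : w • w' = id2 _.
  by apply: colax_faithful; rewrite lwhisk_vcomp lwhisk_id ?qw ?qw' ?pw ?pw' fwd_bwd.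
have K' : w' • w = id2 _.
  by apply: colax_faithful; rewrite lwhisk_vcomp lwhisk_id ?qw ?qw' ?pw ?pw' bwd_fwd.
by exists (@Iso2 _ _ _ k k' w w' K K').
Qed.

Lemma colax_lift (X : C) (y : hom X B) (x : hom X A) (b : cell y (f ∘ x)) :
  exists (k : hom X P) (i : iso2 (q ∘ k) y) (j : iso2 (p ∘ k) x),
    (f ◁ j) • idc • (l ▷ k) = b • i.
Proof.
have [k [i [j [ij ji]]]] := equivalence_esurj (L X) (@Build_CommaOb _ _ (postcomp X f) y x b).
exists k, (@Iso2 _ _ _ (q ∘ k) y (cm_u i) (cm_u j)
  (f_equal (@cm_u _ _ _ _ _) ij) (f_equal (@cm_u _ _ _ _ _) ji)).
exists (@Iso2 _ _ _ (p ∘ k) x (cm_v i) (cm_v j)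
  (f_equal (@cm_v _ _ _ _ _) ij) (f_equal (@cm_v _ _ _ _ _) ji)).
have := cm_sq i; rewrite /= => <-.
by apply: pk_inj; pack.
Qed.
End ColaxBilimits.

(** * From colax bilimits to lax-idempotency *)

Section Free.
Context {C : TwoCat} (T : Pseudomonad C).

Definition alpha_iso x : iso2 (mu T x ∘ pf1 T (mu T x)) (mu T x ∘ mu T (T x)) :=
  @Iso2 _ _ _ (mu T x ∘ pf1 T (mu T x)) (mu T x ∘ mu T (T x)) (alpha_at T x)
    (mod0 (bwd (alpha T)) x)
    (f_equal (fun m => mod0 m x) (fwd_bwd (alpha T)))
    (f_equal (fun m => mod0 m x) (bwd_fwd (alpha T))).
Definition lambda_iso x : iso2 (mu T x ∘ eta T (T x)) (id1 (T x)) :=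
  Iso2 (@lambda_atK C T x) (@lambdaV_atK C T x).
Definition rho_iso x : iso2 (id1 (T x)) (mu T x ∘ pf1 T (eta T x)) :=
  Iso2 (@rho_atK C T x) (@rhoV_atK C T x).

Definition free_alg (x : C) : PsAlg T :=
  @Build_PsAlg C T (T x) (mu T x) (alpha_iso x) (lambda_iso x) (pm_assoc T x) (pm_unit T x).

#[local] Opaque pf2sq pf2un pf2co alpha_at lambda_at rho_at lambdaV_at rhoV_at.

(** This is [act_unit_l] for a free algebra. *)
Lemma mu_mor_unit x :
  (mu T x ◁ lambda_at T (T x)) • idc • (alpha_at T x ▷ eta T (T (T x))) • idc
    • (mu T x ◁ pn1 (eta T) (mu T x))
  = idc • (lambda_at T x ▷ mu T x) • idc.
Proof.
have H := act_unit_l (free_alg x); topack H.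
by apply: pk_inj; pack; noeqc; prw H.
Qed.

Definition mu_mor (x : C) : PsMor (free_alg (T x)) (free_alg x) :=
  @Build_PsMor C T (free_alg (T x)) (free_alg x) (mu T x) (alpha_iso x) (pm_assoc T x)
    (mu_mor_unit x).

(** By [ac_nat] and the image under [T] of the hypothesis, both cells agree after whiskering with
    [mu ∘ T eta], which [rho] identifies with the identity. *)
Lemma free_cell_inj (y : C) (B : PsAlg T) (g h : PsMor (free_alg y) B)
  (s t : PsAlgCell g h) :
  ac0 s ▷ eta T y = ac0 t ▷ eta T y -> ac0 s = ac0 t.
Proof.
move=> E.
have E2 : pf2 T (ac0 s) ▷ pf1 T (eta T y) = pf2 T (ac0 t) ▷ pf1 T (eta T y).
  apply: (fwd_inj (i := pfC T _ _)).
  by rewrite !pfC_rwhisk E.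
have E3 : (ac0 s ▷ mu T y) ▷ pf1 T (eta T y) = (ac0 t ▷ mu T y) ▷ pf1 T (eta T y).
  apply: (fwd_injr (i := iso_rwhisk (pm1 g) (pf1 T (eta T y)))).
  apply: pk_inj; pack; noeqc.
  pstep (f_equal (fun c => c ▷ pf1 T (eta T y)) (ac_nat s)).
  pstep (f_equal (lwhisk (act B)) E2).
  by pback (f_equal (fun c => c ▷ pf1 T (eta T y)) (ac_nat t)).
apply: (fwd_inj_idc (i := iso_lwhisk (pm0 h) (rho_iso y))).
apply: pk_inj; pack; noeqc; topack E3.
have H := interchange (ac0 s) (rho_at T y); topack H; prw (esym H).
have H' := interchange (ac0 t) (rho_at T y); topack H'; prw (esym H').
by rewrite E3.
Qed.
End Free.

Lemma mod_eqc (A B : TwoCat) (F G : Pseudofunctor A B) (s t : @hom (Ps A B) F G) (e : s = t) x :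
  mod0 (eqc e) x = eqc (f_equal (fun r : Pseudonat F G => r x) e).
Proof. by case: t / e. Qed.

(** * The adjunction between [mu] and [eta_T], first objectwise, then in [Ps C C] *)

Section Backward.
Context {C : TwoCat} (T : Pseudomonad C).

(** A cell into [k ∘ a] with [a] left adjoint to [h] is determined by its restriction
    along [h]; a single triangle identity is enough. *)
Lemma cell_inj_unit (X A Y : C) (a : hom X A) (h : hom A X) (e : cell (a ∘ h) (id1 A))
  (u : cell (id1 X) (h ∘ a)) (g : hom X Y) (k : hom A Y) (s t : cell g (k ∘ a)) :
  idc • (e ▷ a) • idc • (a ◁ u) • idc = id2 a -> s ▷ h = t ▷ h -> s = t.
Proof.
move=> E Est.
have R r : pk (r : cell g (k ∘ a)) =
   pk (idc • (k ◁ (e ▷ a)) • idc • ((r ▷ h) ▷ a) • idc • (g ◁ u) • idc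
       : cell g (k ∘ a)).
  pack; noeqc.
  pstep (interchange r u).
  by pstep (f_equal (lwhisk k) E).
by apply: pk_inj; rewrite (R s) (R t) Est.
Qed.

Lemma pm1_unit_inv (A B : PsAlg T) (f : PsMor A B) :
  (bwd (pm1 f) ▷ eta T (pa0 A)) • idc • (pm0 f ◁ bwd (act_unit A)) • idc
  = idc • (act B ◁ pn1 (eta T) (pm0 f)) • idc • (bwd (act_unit B) ▷ pm0 f) • idc
  :> cell (pm0 f) (act B ∘ pf1 T (pm0 f) ∘ eta T (pa0 A)).
Proof.
apply: (fwd_inj_idc (i := iso_rwhisk (pm1 f) (eta T (pa0 A)))).
apply: (fwd_inj_idc (i := iso_lwhisk (pm0 f) (act_unit A))).
apply: pk_inj; pack; noeqc.
pstep (f_equal (fun c => c ▷ eta T (pa0 A)) (fwd_bwd (pm1 f))).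
pstep (f_equal (lwhisk (pm0 f)) (fwd_bwd (act_unit A))).
pstep (pm1_unit f).
by pstep (f_equal (fun c => c ▷ pm0 f) (fwd_bwd (act_unit B))).
Qed.

Lemma lambda_atE x : mod0 (fwd (lambda T)) x = lambda_at T x.
Proof. by []. Qed.
#[local] Opaque pf2sq pf2un pf2co alpha_at lambda_at rho_at lambdaV_at rhoV_at.

Section Unit.
Context (x : C) (Z : PsAlg T) (p : PsMor Z (free_alg T x)) (q : PsMor Z (free_alg T (T x)))
  (l : cell (pm0 q) (eta T (T x) ∘ pm0 p)) (k : hom (T x) (pa0 Z))
  (i : iso2 (pm0 q ∘ k) (eta T (T x))) (j : iso2 (pm0 p ∘ k) (id1 (T x)))
  (ij : idc • (eta T (T x) ◁ j) • idc • (l ▷ k) = i).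

(** [zk] extends [k] to the free algebra on [T x], [kappa] is the comparison of [k] with
    the restriction of [zk], and [P], [Q] identify [p ∘ zk] and [q ∘ zk] with [mu] and,
    up to [rho], the identity. *)
Let zk := act Z ∘ pf1 T k.
Let P : cell (pm0 p ∘ zk) (mu T x) :=
  idc • (mu T x ◁ pf2un T j) • idc • (bwd (pm1 p) ▷ pf1 T k) • idc.
Let QV : cell (mu T (T x) ∘ pf1 T (eta T (T x))) (pm0 q ∘ zk) :=
  idc • (pm1 q ▷ pf1 T k) • idc
  • (mu T (T x) ◁ (bwd (pfC T (pm0 q) k) • pf2 T (bwd i))).
Let Q : cell (pm0 q ∘ zk) (mu T (T x) ∘ pf1 T (eta T (T x))) :=
  (mu T (T x) ◁ (pf2 T i • pfC T (pm0 q) k)) • idc • (bwd (pm1 q) ▷ pf1 T k) • idc.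
Let kappa : cell k (zk ∘ eta T (T x)) :=
  idc • (act Z ◁ pn1 (eta T) k) • idc • (bwd (act_unit Z) ▷ k) • idc.
Let u : cell (id1 (T (T x))) (eta T (T x) ∘ mu T x) :=
  (eta T (T x) ◁ P) • idc • (l ▷ zk) • QV • rho_at T (T x).

(** The unit law of [p] absorbs [bwd (pm1 p)], and [eta_un] pulls [j] out of [pf2un T j], leaving
    [lambda_at] against its inverse. *)
Lemma unit_P : idc • lambda_at T x • (P ▷ eta T (T x)) • idc • (pm0 p ◁ kappa) = j.
Proof.
rewrite /P /kappa /zk; apply: pk_inj; pack; noeqc.
pstep (interchange (bwd (pm1 p)) (pn1 (eta T) k)).
pstep (f_equal (fun c => c ▷ k) (pm1_unit_inv p)).
pstep (f_equal (lwhisk (mu T x)) (eta_un T j)).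
pstep (interchange (lambda_at T x) j).
by pstep (f_equal (fun c => c ▷ (pm0 p ∘ k)) (lambda_atK T x)).
Qed.

(** As for [unit_P], but [i] ends at [eta] instead of an identity, so two further cells survive;
    together with [rhoV_at] they form [thetaV]. *)
Lemma unit_Q : (Q ▷ eta T (T x)) • idc • (pm0 q ◁ kappa)
  = idc • (mu T (T x) ◁ pn1 (eta T) (eta T (T x))) • idc
    • (lambdaV_at T (T x) ▷ eta T (T x)) • idc • i.
Proof.
rewrite /Q /kappa /zk; apply: pk_inj; pack; noeqc.
pstep (interchange (bwd (pm1 q)) (pn1 (eta T) k)).
pstep (f_equal (fun c => c ▷ k) (pm1_unit_inv q)).
pback (f_equal (lwhisk (mu T (T x))) (pn1_comp (eta T) (pm0 q) k)).
pback (f_equal (lwhisk (mu T (T x))) (pn1_nat (eta T) i)).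
by pstep (interchange (lambdaV_at T (T x)) i).
Qed.

(** Composed with [thetaV] and [i], the left side simplifies: [unit_Q] produces a [Q] that cancels
    [QV], [kappa] passes across [l], [unit_P] gives [j], and [ij] returns [i]. *)
Lemma unit_theta :
  idc • (eta T (T x) ◁ lambda_at T x) • idc • (u ▷ eta T (T x)) • idc = theta T (T x).
Proof.
have QK : QV • Q = id2 _.
  rewrite /Q /QV /zk; apply: pk_inj; pack; noeqc.
  pstep (f_equal (lwhisk (mu T (T x))) (f_equal (pf2 T) (bwd_fwd i))); rewrite ?pf2_id; noeqc.
  pstep (f_equal (lwhisk (mu T (T x))) (bwd_fwd (pfC T (pm0 q) k))).
  by pstep (f_equal (fun c => c ▷ pf1 T k) (fwd_bwd (pm1 q))).
have LP := unit_P; have LQ := unit_Q.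
set psi := LHS.
have E : psi • thetaV T (T x) = id2 _.
  apply: (fwd_injr (i := i)); apply: pk_inj; rewrite /psi /u /thetaV; pack; noeqc.
  pback LQ.
  pstep (f_equal (fun c => c ▷ eta T (T x)) (rho_atK T (T x))).
  pstep (f_equal (fun c => c ▷ eta T (T x)) QK).
  pstep (interchange l kappa).
  pstep (f_equal (lwhisk (eta T (T x))) LP).
  by pstep ij.
by rewrite -(vcompc1 psi) -(thetaVK T (T x)) vcompA E vcomp1c.
Qed.
End Unit.

Hypothesis full : locally_full (forgetful T).
Hypothesis colax : colax_bilimit_property (forgetful T).

Lemma unit_exists (x : C) : exists u : cell (id1 (T (T x))) (eta T (T x) ∘ mu T x),
  idc • (eta T (T x) ◁ lambda_at T x) • idc • (u ▷ eta T (T x)) • idc = theta T (T x).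
Proof.
have [Z [p [q [l L]]]] := @colax (free_alg T x) (free_alg T (T x)) (eta T (T x)).
have [k [i [j E]]] := colax_lift L (idc : cell (eta T (T x)) (eta T (T x) ∘ id1 (T x))).
eexists; apply: (@unit_theta x Z p q l k i j).
by apply: pk_inj; topack E; pack.
Qed.

Lemma unit_adj (x : C) : exists u : cell (id1 (T (T x))) (eta T (T x) ∘ mu T x),
  idc • (eta T (T x) ◁ lambda_at T x) • idc • (u ▷ eta T (T x)) • idc = id2 (eta T (T x))
  /\ idc • (lambda_at T x ▷ mu T x) • idc • (mu T x ◁ u) • idc = id2 (mu T x).
Proof.
have [u Eu] := unit_exists x; exists u.
have U : idc • (lambda_at T x ▷ mu T x) • idc • (mu T x ◁ u) • idc = id2 (mu T x).
  set s := LHS.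
  have [s' Es] := @full (free_alg T (T x)) (free_alg T x) (mu_mor T x) (mu_mor T x) s.
  have {}Es : ac0 s' = s := Es.
  rewrite -Es.
  apply: (@free_cell_inj C T (T x) _ (mu_mor T x) (mu_mor T x) s' (ac_id (mu_mor T x))).
  rewrite Es /s /=.
  (* Along [eta], [F] moves [lambda_at] to the other side of [mu ∘ eta], so that [E] exhibits
     [mu ◁ theta], an identity by [G]. *)
  have F := iso_id_comm (lambda_iso T x); topack F.
  have E := f_equal (lwhisk (mu T x)) Eu; topack E.
  have G : mu T x ◁ theta T (T x) = id2 _ := act_theta (free_alg T x); topack G.
  apply: pk_inj; pack; noeqc.
  by prw F; prw E; prw G; noeqc.
split=> //.
(* By [U], [psi] is idempotent, as is one triangle composite once the other is trivial. *)
set psi := (X in X = theta _ _) in Eu.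
have I : psi • psi = psi.
  rewrite /psi; apply: pk_inj; pack; noeqc.
  pstep (interchange u (eta T (T x) ◁ lambda_at T x)).
  pback (f_equal (lwhisk (eta T (T x))) (iso_id_comm (lambda_iso T x))).
  pstep (f_equal (fun c => c ▷ eta T (T x)) (interchange u u)).
  by pstep (f_equal (fun c => eta T (T x) ◁ (c ▷ eta T (T x))) U).
have J : psi = id2 _.
  by rewrite -(vcompc1 psi) -(thetaK T (T x)) vcompA -{1}Eu I Eu thetaK.
by rewrite -J /psi; apply: pk_inj; pack.
Qed.

Lemma counit_of_colax : lax_idempotent T.
Proof.
have [u H] : exists u : forall x, cell (id1 (T (T x))) (eta T (T x) ∘ mu T x), forall x,
    idc • (eta T (T x) ◁ lambda_at T x) • idc • (u x ▷ eta T (T x)) • idc = id2 (eta T (T x))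
    /\ idc • (lambda_at T x ▷ mu T x) • idc • (mu T x ◁ u x) • idc = id2 (mu T x).
  exists (fun x => proj1_sig (constructive_indefinite_description _ (unit_adj x))).
  by move=> x; exact: proj2_sig (constructive_indefinite_description _ (unit_adj x)).
(* The [u x] are chosen independently. Their naturality follows because cells into a composite with
   [mu] are determined along [eta], where the triangle identities fix both sides. *)
have N x y (f : hom x y) :
    (pf1 (pf_comp T T) f ◁ u x) • pn1 (pn_id (pf_comp T T)) f
    = pn1 (pn_comp (eta_T T) (mu T)) f • (u y ▷ pf1 (pf_comp T T) f).
  have [H1 H2] := H x; have [H3 H4] := H y.
  cbn; set s := LHS; set t := RHS.
  have E : idc • s = idc • t :> cell _ (pf1 T (pf1 T f) ∘ eta T (T x) ∘ mu T x).
    apply: (cell_inj_unit (h := eta T (T x)) H2).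
    apply: (fwd_inj_idc (i := iso_lwhisk (pf1 T (pf1 T f) ∘ eta T (T x)) (lambda_iso T x))).
    apply: (fwd_injr_idc (i := pn1 (eta T) (pf1 T f))).
    rewrite /s /t; apply: pk_inj; pack; noeqc.
    pstep (f_equal (lwhisk (pf1 T (pf1 T f))) H1).
    pstep (interchange (u y) (pn1 (eta T) (pf1 T f))).
    pback (interchange (pn1 (eta T) (pf1 T f)) (lambda_at T x)).
    pstep (f_equal (lwhisk (eta T (T y))) (lambda_at_nat T f)).
    by pstep (f_equal (fun c => c ▷ pf1 T f) H3).
  by apply: pk_inj; have := f_equal pk E; rewrite !pk_eqcl.
exists {| mod0 := u : forall x, cell (pn_id (pf_comp T T) x) (pn_comp (eta_T T) (mu T) x);
  mod_nat := N |}.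
split; apply: mod_ext => x; have [H1 H2] := H x; rewrite /= !mod_eqc ?lambda_atE;
  apply: pk_inj; [topack H2 | topack H1]; pack; noeqc;
  [apply: (eq_trans H2) | apply: (eq_trans H1)]; apply: pk_id_eq; strict1.
Qed.
End Backward.

(** * Algebras for a lax-idempotent pseudomonad *)

Section Forward.
Context {C : TwoCat} (T : Pseudomonad C).

Lemma act_thetaV (A : PsAlg T) : act A ◁ thetaV T (pa0 A) = id2 _.
Proof.
by rewrite -[LHS]vcomp1c -{1}(act_theta A) -lwhisk_vcomp thetaK lwhisk_id.
Qed.

Lemma lax_unit : lax_idempotent T -> forall x,
  exists u : cell (id1 (T (T x))) (eta T (T x) ∘ mu T x),
  idc • (eta T (T x) ◁ lambda_at T x) • idc • (u ▷ eta T (T x)) • idc = id2 (eta T (T x))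
  /\ idc • (lambda_at T x ▷ mu T x) • idc • (mu T x ◁ u) • idc = id2 (mu T x).
Proof.
case=> u [H1 H2] x; exists (mod0 u x).
have {}H1 := f_equal (fun m => mod0 m x) H1; rewrite /= !mod_eqc lambda_atE in H1.
have {}H2 := f_equal (fun m => mod0 m x) H2; rewrite /= !mod_eqc lambda_atE in H2.
topack H1; topack H2.
by split; apply: pk_inj; pack; noeqc; [apply: (eq_trans H2) | apply: (eq_trans H1)];
  apply: pk_id_eq; strict1.
Qed.

#[local] Opaque pf2sq pf2un pf2co alpha_at lambda_at rho_at lambdaV_at rhoV_at.

Hypothesis lax : lax_idempotent T.

(** The unit is the pasting of [1 ≅ T a ∘ T eta], the cell [d : T eta => eta_T] and
    [T a ∘ eta_T ≅ eta ∘ a]. *)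
Lemma alg_unit (A : PsAlg T) :
  exists v : cell (id1 (T (pa0 A))) (eta T (pa0 A) ∘ act A),
  idc • (eta T (pa0 A) ◁ act_unit A) • idc • (v ▷ eta T (pa0 A)) • idc
    = id2 (eta T (pa0 A))
  /\ idc • (act_unit A ▷ act A) • idc • (act A ◁ v) • idc = id2 (act A).
Proof.
have [u [H1 H2]] := lax_unit lax (pa0 A).
set a := act A; set x := pa0 A in u H1 H2 *.
(* The comparison [T eta => eta_T] familiar from Kock-Zöberlein monads, obtained from [u] and
   [rho]. *)
pose (d := idc • (eta T (T x) ◁ rhoV_at T x) • idc • (u ▷ pf1 T (eta T x)) • idc
  : cell (pf1 T (eta T x)) (eta T (T x))).
have D1 : lambda_at T x • (mu T x ◁ d) = rhoV_at T x.
  rewrite /d; apply: pk_inj; pack; noeqc.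
  pstep (interchange (lambda_at T x) (rhoV_at T x)).
  by pstep (f_equal (fun c => c ▷ pf1 T (eta T x)) H2).
(* The error term [thetaV] is harmless: moved across the naturality cell of [eta] at [a], it is
   whiskered by [a] and becomes an identity. *)
have D2 : (d ▷ eta T x) • pn1 (eta T) (eta T x) = eta T (T x) ◁ thetaV T x.
  rewrite /d /thetaV; apply: pk_inj; pack; noeqc.
  pstep (interchange u (pn1 (eta T) (eta T x))).
  have E : u ▷ eta T (T x) = idc • (eta T (T x) ◁ lambdaV_at T x) • idc
      :> cell _ (eta T (T x) ∘ mu T x ∘ eta T (T x)).
    apply: (fwd_inj_idc (i := iso_lwhisk (eta T (T x)) (lambda_iso T x))).
    apply: pk_inj; pack; noeqc.
    by pstep H1; pstep (f_equal (lwhisk (eta T (T x))) (lambda_atK T x)).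
  by pstep (f_equal (fun c => c ▷ eta T x) E).
have A1 := act_unital A; have A2 := act_unit_l A; have A3 := eta_un T (act_unit A).
pose (unV := bwd (pf2unI T (act_unit A))
  : cell (id1 (T x)) (pf1 T a ∘ pf1 T (eta T x))).
have K1 : pf2un T (act_unit A) • unV = id2 _ := fwd_bwd (pf2unI T (act_unit A)).
have K2 : unV • pf2un T (act_unit A) = id2 _ := bwd_fwd (pf2unI T (act_unit A)).
move: (unV) K1 K2 => w K1 K2 {unV}.
exists (bwd (pn1 (eta T) a) • (pf1 T a ◁ d) • w); split.
  apply: (fwd_injr_idc (i := iso_lwhisk (eta T x) (act_unit A))).
  apply: pk_inj; pack; noeqc.
  pback A3.
  pstep (f_equal (fun c => c ▷ eta T x) K2).
  pstep (f_equal (lwhisk (pf1 T a)) D2).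
  have P := interchange (pn1 (eta T) a) (thetaV T x); topack P; prw (esym P).
  pstep (f_equal (lwhisk (eta T x)) (act_thetaV A)).
  by pstep (f_equal (fun c => c ▷ eta T x) (bwd_fwd (pn1 (eta T) a))).
apply: pk_inj; pack; noeqc.
pback A2.
pstep (f_equal (lwhisk a) (fwd_bwd (pn1 (eta T) a))).
pstep (interchange (act_mult A) d).
pstep (f_equal (lwhisk a) D1).
pstep A1.
pstep (f_equal (lwhisk a) (rhoV_atK T x)).
by pstep (f_equal (lwhisk a) K1).
Qed.

(** Both sides of [ac_nat] are cells into [pm0 g ∘ act A], so it suffices to compare them along
    [eta], where the unit laws of [f] and [g] apply. *)
Lemma forgetful_locally_full : locally_full (forgetful T).
Proof.
move=> A B f g s.
change (cell (pm0 f) (pm0 g)) in s.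
suff E : (s ▷ act A) • pm1 f = pm1 g • (act B ◁ pf2 T s) by exists (Build_PsAlgCell E).
have [v [V1 V2]] := alg_unit A.
apply: (cell_inj_unit V2).
apply: (fwd_inj_idc (i := iso_lwhisk (pm0 g) (act_unit A))).
apply: (fwd_injr_idc (i := iso_lwhisk (act B) (pn1 (eta T) (pm0 f)))).
apply: pk_inj; pack; noeqc.
pback (interchange s (act_unit A)).
pstep (pm1_unit f).
pstep (f_equal (lwhisk (act B)) (esym (pn1_nat (eta T) s))).
pstep (pm1_unit g).
by pstep (interchange (act_unit B) s).
Qed.

(** The lax structure is the mate of [eta] at [f] under the adjunctions [act ⊣ eta]. *)
Lemma lax_mor (A B : PsAlg T) (f : hom (pa0 A) (pa0 B)) :
  exists phi : cell (act B ∘ pf1 T f) (f ∘ act A),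
  (f ◁ act_unit A) • idc • (phi ▷ eta T (pa0 A)) • idc • (act B ◁ pn1 (eta T) f)
  = idc • (act_unit B ▷ f) • idc.
Proof.
have [v [V1 V2]] := alg_unit A; set a := act A in v V1 V2 *; set b := act B.
exists (idc • (act_unit B ▷ (f ∘ a)) • idc • (b ◁ (bwd (pn1 (eta T) f) ▷ a)) • idc
  • ((b ∘ pf1 T f) ◁ v) • idc).
apply: pk_inj; pack; noeqc.
pback (interchange (act_unit B) (f ◁ act_unit A)).
pback (f_equal (lwhisk b) (interchange (bwd (pn1 (eta T) f)) (act_unit A))).
pstep (f_equal (lwhisk (b ∘ pf1 T f)) V1).
by pstep (f_equal (lwhisk b) (bwd_fwd (pn1 (eta T) f))).
Qed.

(** Both sides end in a composite with [mu], so they can be compared along [eta]; there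
    [act_unit_l], [lambda_at_nat] and the hypothesis on units collapse them. *)
Lemma lax_mor_mult (A B : PsAlg T) (f : hom (pa0 A) (pa0 B))
  (phi : cell (act B ∘ pf1 T f) (f ∘ act A)) :
  (f ◁ act_unit A) • idc • (phi ▷ eta T (pa0 A)) • idc • (act B ◁ pn1 (eta T) f)
  = idc • (act_unit B ▷ f) • idc ->
  (f ◁ act_mult A) • idc • (phi ▷ pf1 T (act A)) • idc • (act B ◁ pf2sq T phi)
  = idc • (phi ▷ mu T (pa0 A)) • idc • (act B ◁ pn1 (mu T) f) • idc
    • (act_mult B ▷ pf1 T (pf1 T f)) • idc.
Proof.
move=> Hu; set s := LHS; set t := RHS.
have [u [_ U2]] := lax_unit lax (pa0 A).
(* Rebracketing the target gives the form [k ∘ mu] that [cell_inj_unit] asks for. *)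
suff E : eqc (comp1A f (act A) (mu T (pa0 A))) • s = eqc (comp1A _ _ _) • t.
  by apply: pk_inj; have := f_equal pk E; rewrite !pk_eqcl.
apply: (cell_inj_unit U2).
apply: (fwd_inj_idc (i := iso_lwhisk (f ∘ act A) (lambda_iso T (pa0 A)))).
apply: (fwd_injr_idc (i := iso_lwhisk (act B ∘ pf1 T (act B)) (pn1 (eta T) (pf1 T f)))).
apply: (fwd_injr_idc (i := iso_lwhisk (act B) (iso_rwhisk (pn1 (eta T) (act B)) (pf1 T f)))).
rewrite /s /t; apply: pk_inj; pack; noeqc.
pstep (f_equal (lwhisk (act B)) (eta_sq T phi)).
pstep (interchange phi (pn1 (eta T) (act A))).
pstep (f_equal (lwhisk f) (act_unit_l A)).
pstep (f_equal (fun c => c ▷ act A) Hu).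
pback (interchange phi (lambda_at T (pa0 A))).
pstep (interchange (act_mult B) (pn1 (eta T) (pf1 T f))).
pstep (f_equal (lwhisk (act B)) (lambda_at_nat T f)).
pstep (f_equal (fun c => c ▷ pf1 T f) (act_unit_l B)).
by pstep (interchange (act_unit B) phi).
Qed.
End Forward.

(** In this section [(c, cm, cu)] need not satisfy the axioms of a pseudoalgebra, while [p]
    satisfies those of a pseudomorphism into [A]. *)
Section Transport.
Context {C : TwoCat} (T : Pseudomonad C).
Context (A : PsAlg T) {P : C} (c : hom (T P) P) (cm : iso2 (c ∘ pf1 T c) (c ∘ mu T P))
  (cu : iso2 (c ∘ eta T P) (id1 P)) (p : hom P (pa0 A))
  (pb : iso2 (act A ∘ pf1 T p) (p ∘ c)).
Hypothesis Pm :
  (p ◁ cm) • idc • (pb ▷ pf1 T c) • idc • (act A ◁ pf2sq T pb)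
  = idc • (pb ▷ mu T P) • idc • (act A ◁ pn1 (mu T) p) • idc
    • (act_mult A ▷ pf1 T (pf1 T p)) • idc.
Hypothesis Pu :
  (p ◁ cu) • idc • (pb ▷ eta T P) • idc • (act A ◁ pn1 (eta T) p)
  = idc • (act_unit A ▷ p) • idc.

#[local] Opaque pf2sq pf2un pf2co alpha_at lambda_at rho_at lambdaV_at rhoV_at.

(** Pasting with [pb] and its image under [T] carries the equation to [act_unital A]. The whiskering
    with [p] disappears later, when [colax_faithful] combines both legs. *)
Lemma transport_unital :
  p ◁ ((cm ▷ pf1 T (eta T P)) • idc)
  = p ◁ (idc • (c ◁ rho_at T P) • (c ◁ pf2un T cu)).
Proof.
have Tu := pf2sq_unit T (e := cu) (s := pb) (n := pn1 (eta T) p) (e' := act_unit A).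
have {}Tu := Tu ltac:(by apply: pk_inj; topack Pu; pack; prw Pu; noeqc).
apply: (fwd_injr_idc (i := iso_rwhisk pb (pf1 T c ∘ pf1 T (eta T P)))).
apply: (fwd_injr_idc (i := iso_lwhisk (act A) (iso_rwhisk (pf2sqI T pb) (pf1 T (eta T P))))).
apply: (fwd_injr_idc (i := iso_lwhisk (act A ∘ pf1 T (act A)) (pf2sqI T (pn1 (eta T) p)))).
apply: pk_inj; pack; noeqc.
pstep (f_equal (fun b => b ▷ pf1 T (eta T P)) Pm).
pstep (interchange (act_mult A) (pf2sq T (pn1 (eta T) p))).
pstep (f_equal (fun b => b ▷ pf1 T p) (act_unital A)).
pback (interchange pb (pf2un T cu)).
pback (interchange pb (rho_at T P)).
pstep (f_equal (lwhisk (act A)) Tu).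
by pstep (f_equal (lwhisk (act A)) (rho_at_nat T p)).
Qed.

(** Likewise reduced to [act_assoc A], using [Pm] and its image under [T]. *)
Lemma transport_assoc :
  p ◁ ((c ◁ alpha_at T P) • idc • (cm ▷ pf1 T (mu T P)) • idc • (c ◁ pf2sq T cm))
  = p ◁ (idc • (cm ▷ mu T (T P)) • idc • (c ◁ pn1 (mu T) c) • idc
         • (cm ▷ pf1 T (pf1 T c)) • idc).
Proof.
have TPm := pf2sq_cube T Pm.
apply: (fwd_injr_idc (i := iso_rwhisk pb (pf1 T c ∘ pf1 T (pf1 T c)))).
apply: (fwd_injr_idc (i := iso_lwhisk (act A) (iso_rwhisk (pf2sqI T pb) (pf1 T (pf1 T c))))).
apply: (fwd_injr_idc (i := iso_lwhisk (act A ∘ pf1 T (act A)) (pf2sqI T (pf2sqI T pb)))).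
apply: pk_inj; pack; noeqc.
pback (interchange pb (pf2sq T cm)).
pstep (f_equal (lwhisk (act A)) TPm).
pstep (f_equal (fun b => b ▷ pf1 T (mu T P)) Pm).
pstep (interchange (act_mult A) (pf2sq T (pn1 (mu T) p))).
pback (interchange pb (alpha_at T P)).
pstep (f_equal (lwhisk (act A)) (alpha_at_nat T p)).
pstep (f_equal (fun b => b ▷ pf1 T (pf1 T (pf1 T p))) (act_assoc A)).
pstep (f_equal (fun b => b ▷ pf1 T (pf1 T c)) Pm).
pstep (interchange (act_mult A) (pf2sq T (pf2sq T pb))).
pback (interchange pb (pn1 (mu T) c)).
pback (f_equal (lwhisk (act A)) (mu_sq T pb)).
pstep (f_equal (fun b => b ▷ mu T (T P)) Pm).
by pstep (interchange (act_mult A) (pn1 (mu T) (pf1 T p))).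
Qed.
End Transport.

(** * Lifting a colax bilimit to pseudoalgebras *)

Section Isos.
Context {C : TwoCat} {A B : C}.

Definition iso_inv (f g : hom A B) (i : iso2 f g) : iso2 g f := Iso2 (bwd_fwd i) (fwd_bwd i).

Program Definition iso_comp (f g h : hom A B) (j : iso2 g h) (i : iso2 f g) : iso2 f h :=
  @Iso2 _ _ _ f h (j • i) (bwd i • bwd j) _ _.
Next Obligation. by rewrite -vcompA (vcompA i) fwd_bwd vcomp1c fwd_bwd. Qed.
Next Obligation. by rewrite -vcompA (vcompA (bwd j)) bwd_fwd vcomp1c bwd_fwd. Qed.

(** Transparent, since [lift_unit] and [lift_mult] end by conversion. *)
Definition iso_eqc (f g : hom A B) (e : f = g) : iso2 f g.
Proof.
exists (eqc e) (eqc (esym e)); first by case: g / e; rewrite /= vcomp1c.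
by case: g / e; rewrite /= vcomp1c.
Defined.

Lemma iso_factor (f g h : hom A B) (i : iso2 f g) (r : iso2 f h) :
  exists v : iso2 g h, v • i = r.
Proof.
by exists (iso_comp r (iso_inv i)); rewrite /= -vcompA bwd_fwd vcompc1.
Qed.
End Isos.
Notation isoe := (iso_eqc strict_eq).

Section Lift.
Context {C : TwoCat} (T : Pseudomonad C).
#[local] Opaque pf2sq pf2un pf2co alpha_at lambda_at rho_at lambdaV_at rhoV_at.

Section Components.
Context (A : PsAlg T) {P : C} (c : hom (T P) P) (p : hom P (pa0 A))
  (pb : iso2 (act A ∘ pf1 T p) (p ∘ c)).

(** All other cells in the unit law of a pseudomorphism are invertible, so the law can be solved for
    [p ◁ cu] before [cu] exists. *)
Lemma lift_unit : exists v : iso2 (p ∘ (c ∘ eta T P)) (p ∘ id1 P),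
  v • idc • (pb ▷ eta T P) • idc • (act A ◁ pn1 (eta T) p)
  = idc • (act_unit A ▷ p) • idc.
Proof.
have [v E] := iso_factor
  (iso_comp isoe (iso_comp (iso_rwhisk pb (eta T P))
    (iso_comp isoe (iso_lwhisk (act A) (pn1 (eta T) p))))
    : iso2 (act A ∘ (eta T (pa0 A) ∘ p)) (p ∘ (c ∘ eta T P)))
  (iso_comp isoe (iso_comp (iso_rwhisk (act_unit A) p) isoe)
    : iso2 (act A ∘ (eta T (pa0 A) ∘ p)) (p ∘ id1 P)).
exists v; exact: E.
Qed.

Lemma lift_mult : exists w : iso2 (p ∘ (c ∘ pf1 T c)) (p ∘ (c ∘ mu T P)),
  w • idc • (pb ▷ pf1 T c) • idc • (act A ◁ pf2sq T pb)
  = idc • (pb ▷ mu T P) • idc • (act A ◁ pn1 (mu T) p) • idc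
    • (act_mult A ▷ pf1 T (pf1 T p)) • idc.
Proof.
have [w E] := iso_factor
  (iso_comp isoe (iso_comp (iso_rwhisk pb (pf1 T c))
    (iso_comp isoe (iso_lwhisk (act A) (pf2sqI T pb))))
    : iso2 (act A ∘ (pf1 T (act A) ∘ pf1 T (pf1 T p))) (p ∘ (c ∘ pf1 T c)))
  (iso_comp isoe (iso_comp (iso_rwhisk pb (mu T P))
    (iso_comp isoe (iso_comp (iso_lwhisk (act A) (pn1 (mu T) p))
    (iso_comp isoe (iso_comp (iso_rwhisk (act_mult A) (pf1 T (pf1 T p))) isoe)))))
    : iso2 (act A ∘ (pf1 T (act A) ∘ pf1 T (pf1 T p))) (p ∘ (c ∘ mu T P))).
exists w; exact: E.
Qed.
End Components.

Hypothesis lax : lax_idempotent T.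

Lemma forgetful_colax (A B : PsAlg T) (f : hom (pa0 A) (pa0 B)) (P : C)
  (p : hom P (pa0 A)) (q : hom P (pa0 B)) (l : cell q (f ∘ p)) :
  is_colax_bilimit l ->
  exists (Z : PsAlg T) (p' : PsMor Z A) (q' : PsMor Z B) (l' : cell (pm0 q') (f ∘ pm0 p')),
    is_colax_bilimit l'.
Proof.
move=> L; have [phi Hu] := lax_mor lax f; have Hm := lax_mor_mult lax Hu.
(* The action [c] classifies the cone on [T P] formed by [phi] and the image of [l]. *)
have [c [i [j E]]] := colax_lift L (idc • (phi ▷ pf1 T p) • idc • (act B ◁ pf2co T l)
  : cell (act B ∘ pf1 T q) (f ∘ (act A ∘ pf1 T p))).
have {E} [qb [pb E]] : exists (qb : iso2 (act B ∘ pf1 T q) (q ∘ c))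
    (pb : iso2 (act A ∘ pf1 T p) (p ∘ c)),
  (l ▷ c) • qb = idc • (f ◁ pb) • idc • (phi ▷ pf1 T p) • idc • (act B ◁ pf2co T l).
  exists (iso_inv i), (iso_inv j).
  apply: (fwd_injr (i := i)); apply: (fwd_inj_idc (i := iso_lwhisk f j)).
  apply: pk_inj; pack; noeqc; topack E; rewrite -E.
  pstep (bwd_fwd i).
  by pstep (f_equal (lwhisk f) (fwd_bwd j)).
have [v Ev] := lift_unit pb; have [u Eu] := lift_unit qb.
(* This compatibility with [l] lets [v] and [u] come from a single cell [cu]. *)
have Kcu : (f ◁ v) • idc • (l ▷ (c ∘ eta T P)) = idc • (l ▷ id1 P) • u.
  apply: (fwd_injr_idc (i := iso_rwhisk qb (eta T P))).
  apply: (fwd_injr_idc (i := iso_lwhisk (act B) (pn1 (eta T) q))).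
  apply: pk_inj; pack; noeqc.
  pstep Eu.
  pstep (f_equal (fun b => b ▷ eta T P) E).
  pstep (f_equal (lwhisk (act B)) (eta_co T l)).
  pstep (interchange phi (pn1 (eta T) p)).
  pstep (f_equal (lwhisk f) Ev).
  pstep (f_equal (fun b => b ▷ p) Hu).
  by pstep (interchange (act_unit B) l).
have [cu [qcu pcu]] := colax_full L Kcu.
have [w Ew] := lift_mult pb; have [w' Ew'] := lift_mult qb.
(* The multiplication involves [pf1 T c], hence [E] under [T] as well. *)
have TE := pf2co_prism T E.
have Kcm : (f ◁ w) • idc • (l ▷ (c ∘ pf1 T c)) = idc • (l ▷ (c ∘ mu T P)) • w'.
  apply: (fwd_injr_idc (i := iso_rwhisk qb (pf1 T c))).
  apply: (fwd_injr_idc (i := iso_lwhisk (act B) (pf2sqI T qb))).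
  apply: pk_inj; pack; noeqc.
  pstep (f_equal (fun b => b ▷ pf1 T c) E).
  pstep (f_equal (lwhisk (act B)) TE).
  pstep (interchange phi (pf2sq T pb)).
  pstep (f_equal (lwhisk f) Ew).
  pstep (f_equal (fun b => b ▷ pf1 T (pf1 T p)) Hm).
  pstep (interchange (act_mult B) (pf2co T (pf2co T l))).
  pstep Ew'.
  pstep (f_equal (fun b => b ▷ mu T P) E).
  pstep (f_equal (lwhisk (act B)) (mu_co T l)).
  by pstep (interchange phi (pn1 (mu T) p)).
have [cm [qcm pcm]] := colax_full L Kcm.
(* With [v], [u], [w], [w'] read as whiskerings of [cu] and [cm], these are the pseudomorphism
   axioms for [p] and [q], which the transport lemmas take as input. *)
rewrite -pcu in Ev; rewrite -qcu in Eu; rewrite -pcm in Ew; rewrite -qcm in Ew'.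
pose Z := @Build_PsAlg C T P c cm cu
  (colax_faithful L (transport_assoc Ew') (transport_assoc Ew))
  (colax_faithful L (transport_unital Ew' Eu) (transport_unital Ew Ev)).
by exists Z, (@Build_PsMor C T Z A p pb Ew Ev), (@Build_PsMor C T Z B q qb Ew' Eu), l.
Qed.
End Lift.


Theorem theorem4p5 (C : TwoCat) (T : Pseudomonad C)
    (hC : has_colax_bilimits_of_arrows C) :
  lax_idempotent T <->
  locally_full (forgetful T) /\ colax_bilimit_property (forgetful T).
Proof.
split=> [lax|[full colax]]; last exact: counit_of_colax.
split; first exact: forgetful_locally_full.
move=> A B f; have [P [p [q [l L]]]] := hC _ _ f.
exact: (@forgetful_colax C T lax A B f P p q l L).
Qed.
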